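(* Let $t$ be a positive integer. There is a real-valued function $f = f(\Delta,t)$ with $f(\Delta,t) = (1+o(1))\,\dfrac{\Delta^t}{t\log\Delta}$ as $\Delta\to\infty$ (with $t$ fixed) such that, for every integer $g\ge 3$ and every positive integer $\Delta$, there is a graph $G$ of girth at least $g$ and maximum degree at most $\Delta$ with $\chi'_t(G)\ge f(\Delta,t)$. (The function $f$ does not depend on $g$.)
   Context: Graphs are finite and have no loops or parallel edges. The girth of a graph is the length of its shortest cycle ($\infty$ if it has no cycle); $\log$ is the natural logarithm. The distance between two distinct edges of a graph $G$ is the number of vertices in a shortest path between them (so adjacent edges have distance $1$); equivalently, it is their distance as vertices of the line graph $L(G)$. A distance-$t$ edge-colouring of $G$ is a colouring of the edges of $G$ such that no two distinct edges at distance at most $t$ receive the same colour. The distance-$t$ chromatic index $\chi'_t(G)$ is the least integer $k$ such that $G$ has a distance-$t$ edge-colouring using $k$ colours. *)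

(* Defs.v *)
From mathcomp Require Import all_boot all_order all_algebra.
From mathcomp Require Import boolp constructive_ereal.

Set Implicit Arguments.
Unset Strict Implicit.
Unset Printing Implicit Defensive.

Import Order.TTheory GRing.Theory Num.Theory.

Record sgraph := SGraph {
  vertex :> finType;
  adj : rel vertex;
  adj_sym : symmetric adj;
  adj_irrefl : irreflexive adj }.

Arguments adj {s}.

(* Minimum of a set of natural numbers, with value +oo on the empty set;
   \bar int is used only to have an ordered type containing nat and +oo. *)
Definition min_or_oo (P : nat -> Prop) : \bar int :=
  match pselect (exists n, `[< P n >]) with
  | left exP => (Posz (ex_minn exP))%:E
  | right _ => +oo%E
  end.

Section Graph.
Variable G : sgraph.

Definition max_degree : nat := \max_(v : G) #|[set w : G | adj v w]|%SET.

(* A closed sequence of two adjacent vertices satisfies ucycle, hence the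
   lower bound on the size. *)
Definition graph_cycle (c : seq G) : Prop := ucycle adj c /\ 2 < size c.

Definition girth : \bar int :=
  min_or_oo (fun n => exists c : seq G, graph_cycle c /\ size c = n).

Definition edges : {set {set G}} :=
  [set a : {set G} |
     [exists u : G, exists v : G, adj u v && (a == [set u; v])]]%SET.

(* The vertex sequence x :: p is a path joining an end of a to an end of b. *)
Definition path_between (a b : {set G}) (x : G) (p : seq G) : Prop :=
  [/\ x \in a, last x p \in b, path adj x p & uniq (x :: p)].

(* Number of vertices in a shortest path; only meaningful for distinct edges. *)
Definition edge_dist (a b : {set G}) : \bar int :=
  min_or_oo (fun n => exists x p, path_between a b x p /\ size (x :: p) = n).

Definition distance_edge_colouring (t k : nat) (col : {set G} -> nat) : Prop :=
  (forall a, a \in edges -> col a < k) /\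
  (forall a b, a \in edges -> b \in edges -> a != b ->
     (edge_dist a b <= (Posz t)%:E)%E -> col a != col b).

Definition distance_edge_colourable (t k : nat) : Prop :=
  exists col, distance_edge_colouring t k col.

Lemma distance_edge_colourable_ex (t : nat) :
  exists k, `[< distance_edge_colourable t k >].
Proof.
exists #|{: {set G}}|; apply/asboolP.
exists (fun a => nat_of_ord (enum_rank a)); split=> [a _|a b _ _ ab _]; first exact: ltn_ord.
by apply: contraNneq ab => /ord_inj/enum_rank_inj ->.
Qed.

Definition distance_chromatic_index (t : nat) : nat :=
  ex_minn (distance_edge_colourable_ex t).

End Graph.

(* Main.v *)
(** Proof idea. Pair off uniformly at random the [N = n d] half-edges at [n] vertices of
degree [d] (the configuration model). For fixed [d] and [g] the expected number of
half-edges that start a short closed walk is bounded independently of [n]; deleting the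
corresponding edges gives girth at least [g] and leaves all but boundedly many edges "deep",
that is, far from every deletion. A colour class of deep edges consists of edges whose balls
of radius about [t/2] are disjoint trees. Revealing these balls half-edge by half-edge for
[m] given edges, the [k]-th answer must avoid all half-edges at the vertices already seen,
so that all balls are disjoint with probability at most [exp (- 2 m (m-1) (d-2)^t / N)].
With [m = p N] and [p] slightly larger than [t ln d / (2 d^t)] this beats the number
[C(N, m)] of choices of the edges, so some pairing has colour classes of fewer than [m] deep
edges, and needs at least about [N / (2 m) = 1 / (2 p)] colours. *)

Require Import Defs.
From HB Require Import structures.
From mathcomp Require Import all_boot all_order all_algebra.
From mathcomp Require Import all_classical all_reals all_analysis.
From mathcomp Require Import ssrbool eqtype ssrnat seq fintype bigop finset.
From mathcomp Require Import all_fingroup zify ring lra.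
Import Order.TTheory GRing.Theory Num.Theory.
Import numFieldNormedType.Exports.

Set Implicit Arguments.
Unset Strict Implicit.
Unset Printing Implicit Defensive.

(** * Adaptive exploration of a random pairing *)

Section Exploration.
Variable H : finType.

Definition pairings : {set {perm H}} :=
  [set sg : {perm H} | [forall h, (sg (sg h) == h) && (sg h != h)]].

Lemma pairingK sg : sg \in pairings -> involutive sg.
Proof. by rewrite inE => /forallP sgP h; have /andP[/eqP] := sgP h. Qed.

Lemma pairing_neq sg h : sg \in pairings -> sg h != h.
Proof. by rewrite inE => /forallP sgP; have /andP[] := sgP h. Qed.

Lemma pairingsP (sg : {perm H}) :
  involutive sg -> (forall h, sg h != h) -> sg \in pairings.
Proof. by move=> sgK sgN; rewrite inE; apply/forallP=> h; rewrite sgK eqxx sgN. Qed.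

Lemma pairingJ sg x : sg \in pairings -> (sg ^ x)%g \in pairings.
Proof.
move=> sgP; apply: pairingsP => h; rewrite -[h](permKV x) !permJ.
  by rewrite (pairingK sgP).
by rewrite (inj_eq perm_inj) pairing_neq.
Qed.

(* An exploration repeatedly asks for the partner of a half-edge. Since the next query
   [qry s] depends only on the list [s] of answers so far, [s] alone encodes the history;
   the exploration survives a step when the answer [p] satisfies [ok s p]. *)
Variables (qry : seq H -> H) (ok : seq H -> pred H).

Definition revealed (s : seq H) : seq H :=
  s ++ [seq qry (take i s) | i <- iota 0 (size s)].

Definition legal (s : seq H) : {set H} :=
  [set p | [&& ok s p, p \notin revealed s & p != qry s]].

Inductive valid : seq H -> Prop :=
| valid_nil : valid [::]
| valid_rcons s p : valid s -> p \in legal s -> valid (rcons s p).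

Fixpoint answers (sg : H -> H) (k : nat) : seq H :=
  if k is k'.+1 then rcons (answers sg k') (sg (qry (answers sg k'))) else [::].

Definition extensions (s : seq H) : {set {perm H}} :=
  [set sg in pairings | answers sg (size s) == s].

Definition survivors (J : nat) : {set {perm H}} :=
  [set sg in pairings | [forall k : 'I_J, ok (answers sg k) (sg (qry (answers sg k)))]].

Lemma size_answers sg k : size (answers sg k) = k.
Proof. by elim: k => //= k IHk; rewrite size_rcons IHk. Qed.

Lemma revealed_rcons s p :
  revealed (rcons s p) =i p :: qry s :: revealed s.
Proof.
move=> x; rewrite /revealed size_rcons -addn1 iotaD map_cat /= add0n.
have -> : [seq qry (take i (rcons s p)) | i <- iota 0 (size s)]
        = [seq qry (take i s) | i <- iota 0 (size s)].
  apply/eq_in_map => i; rewrite mem_iota /= add0n => /ltnW lei.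
  by rewrite -cats1 takel_cat.
rewrite -cats1 takel_cat ?take_size // !(mem_cat, inE).
by do !case: (_ \in _); do ?case: (_ == _).
Qed.

Lemma size_revealed s : size (revealed s) = (size s).*2.
Proof. by rewrite size_cat size_map size_iota addnn. Qed.

Lemma extensions_rcons s p sg :
  (sg \in extensions (rcons s p)) = (sg \in extensions s) && (sg (qry s) == p).
Proof.
rewrite !inE size_rcons /= -andbA; congr (_ && _).
rewrite eqseq_rcons; case: eqP => //= ->; by [].
Qed.

Lemma extensions_revealed s sg h :
  sg \in extensions s -> h \in revealed s -> sg h \in revealed s.
Proof.
elim/last_ind: s h => [|s p IHs] h //; rewrite extensions_rcons.
case/andP=> sgs /eqP sgq; rewrite !revealed_rcons !inE.
have sgP : sg \in pairings by move: sgs; rewrite inE => /andP[].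
case/or3P => [/eqP->|/eqP->|/(IHs _ sgs)->]; last by rewrite !orbT.
  by rewrite -sgq (pairingK sgP) eqxx orbT.
by rewrite sgq eqxx.
Qed.

Lemma extensions_fresh s sg :
  sg \in extensions s -> qry s \notin revealed s -> sg (qry s) \notin revealed s.
Proof.
move=> sgs; apply: contra => /(extensions_revealed sgs).
by rewrite (pairingK _) //; move: sgs; rewrite inE => /andP[].
Qed.

Variable J : nat.
Hypothesis fresh : forall s, valid s -> size s < J -> qry s \notin revealed s.

Lemma revealed_uniq s : valid s -> size s <= J -> uniq (revealed s).
Proof.
elim=> // {}s p vs IHs; rewrite inE => /and3P[_ pN pq]; rewrite size_rcons => lts.
have us := IHs (ltnW lts); have qN := fresh vs lts.
have /card_uniqP E : uniq (p :: qry s :: revealed s) by rewrite /= inE negb_or pq pN qN.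
apply/card_uniqP; rewrite (eq_card (revealed_rcons s p)) E /=.
by rewrite !size_revealed size_rcons.
Qed.

Lemma card_unqueried s : valid s -> size s < J ->
  #|[set p | (p \notin revealed s) && (p != qry s)]| = (#|H| - (size s).*2).-1.
Proof.
move=> vs lts.
have -> : [set p | (p \notin revealed s) && (p != qry s)]
        = ~: [set x in qry s :: revealed s].
  by apply/setP=> x; rewrite !inE negb_or andbC.
rewrite cardsCs setCK cardsE (card_uniqP _) /= ?(revealed_uniq vs (ltnW lts)) ?fresh //.
by rewrite size_revealed subnS.
Qed.

Lemma card_legal_leq s : valid s -> size s < J ->
  #|legal s| <= (#|H| - (size s).*2).-1.
Proof.
move=> vs lts; rewrite -card_unqueried //; apply/subset_leq_card/subsetP=> p.
by rewrite !inE => /and3P[_ -> ->].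
Qed.

(* The pairings extending [s] by the answer [p] are conjugated to those extending it
   by [p'] through the transposition of [p] and [p']. *)
Lemma card_extensions_leq s p p' :
  valid s -> size s < J ->
  p \notin revealed s -> p != qry s -> p' \notin revealed s -> p' != qry s ->
  #|extensions (rcons s p)| <= #|extensions (rcons s p')|.
Proof.
move=> vs lts pN pq p'N p'q.
rewrite -(card_imset _ (conjg_inj (tperm p p'))); apply/subset_leq_card/subsetP=> x.
case/imsetP=> sg sgE ->; move: sgE {x}; rewrite !extensions_rcons => /andP[sgs /eqP sgq].
have fixt x : x \in revealed s -> tperm p p' x = x.
  by move=> xs; rewrite tpermD //; [apply: contraNneq pN | apply: contraNneq p'N] => ->.
have fixq : tperm p p' (qry s) = qry s by rewrite tpermD.
rewrite -{1}fixq permJ sgq tpermL eqxx andbT.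
have sgP : sg \in pairings by move: sgs; rewrite inE => /andP[].
(* The transposition moves no revealed half-edge, so conjugating by it preserves every answer of the
   history; this goes by induction on [s]. *)
clear - sgs fixt sgP.
elim/last_ind: s sgs fixt => [|s y IHs].
  by move=> _ _; rewrite inE pairingJ.
rewrite !extensions_rcons => /andP[sgs /eqP sgq] fixt.
rewrite IHs //=; last by move=> x xs; apply: fixt; rewrite revealed_rcons !inE xs !orbT.
have fixq : tperm p p' (qry s) = qry s by rewrite fixt // revealed_rcons !inE eqxx orbT.
by rewrite -{1}fixq permJ sgq fixt // revealed_rcons !inE eqxx.
Qed.

(** Sorting the pairings that extend [s] by the partner of [qry s] gives one class per available
    half-edge; [card_extensions_leq], used in both directions, makes these classes equally large. *)
Lemma card_extensions_eq s p :
  valid s -> size s < J -> p \notin revealed s -> p != qry s ->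
  #|extensions s| = (#|H| - (size s).*2).-1 * #|extensions (rcons s p)|.
Proof.
move=> vs lts pN pq.
pose F := [set x | (x \notin revealed s) && (x != qry s)].
have cF : #|F| = (#|H| - (size s).*2).-1 := card_unqueried vs lts.
have <- : \sum_(x in F) #|extensions (rcons s x)| = #|extensions s|.
  rewrite -sum1_card (partition_big (fun sg : {perm H} => sg (qry s)) (mem F)) /=.
    apply: eq_bigr => x _; rewrite -sum1_card; apply: eq_bigl => sg.
    by rewrite extensions_rcons.
  move=> sg sgs; rewrite inE extensions_fresh ?fresh //= pairing_neq //.
  by move: sgs; rewrite inE => /andP[].
rewrite -cF -sum_nat_const; apply: eq_bigr => x; rewrite inE => /andP[xN xq].
by apply/eqP; rewrite eqn_leq !card_extensions_leq.
Qed.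

Local Open Scope ring_scope.

(** Chain rule: given the history, the next answer is uniform on the available half-edges, so
    [rho k] bounds the conditional probability of surviving step [k]. *)
Lemma card_survivors (R : realFieldType) (rho : nat -> R) :
  (forall k, 0 <= rho k) ->
  (forall s, valid s -> (size s < J)%N ->
     #|legal s|%:R <= rho (size s) * (#|H| - (size s).*2).-1%:R) ->
  #|survivors J|%:R <= \prod_(k < J) rho k * #|pairings|%:R.
Proof.
move=> rho_ge0 le_legal.
suff main i s : valid s -> (size s + i = J)%N ->
    #|survivors J :&: extensions s|%:R
      <= \prod_(size s <= k < J) rho k * #|extensions s|%:R.
  have := main J [::] valid_nil (add0n J); rewrite big_mkord.
  have -> : extensions [::] = pairings by apply/setP=> sg; rewrite inE andbT.
  rewrite (setIidPl _) //; by apply/subsetP=> sg; rewrite inE => /andP[].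
elim: i s => [|i IHi] s vs.
  rewrite addn0 => eqJ; rewrite eqJ big_geq // mul1r ler_nat.
  by rewrite subset_leq_card // subsetIr.
move=> eqJ; have lts : (size s < J)%N by rewrite -eqJ -addSnnS leq_addr.
have -> : #|survivors J :&: extensions s|
        = (\sum_(p in legal s) #|survivors J :&: extensions (rcons s p)|)%N.
  rewrite -sum1_card (partition_big (fun sg : {perm H} => sg (qry s)) (mem (legal s))) /=.
    apply: eq_bigr => x _; rewrite -sum1_card; apply: eq_bigl => sg.
    by rewrite !in_setI extensions_rcons andbA.
  move=> sg /setIP[sgJ sgs]; rewrite inE extensions_fresh ?fresh //=.
  move: sgJ; rewrite inE => /andP[sgP /forallP/(_ (Ordinal lts))] /=.
  by move: sgs; rewrite inE => /andP[_ /eqP->] ->; rewrite pairing_neq.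
rewrite big_ltn // natr_sum.
(* Without a legal answer there are no survivors; otherwise [p0] is a reference, since every legal
   answer has as many extensions. *)
have [p0 p0L|L0] := pickP (mem (legal s)); last first.
  rewrite big_pred0 //; rewrite !mulr_ge0 ?prodr_ge0 // ?ler0n // => k _; exact: rho_ge0.
have := p0L; rewrite /= inE => /and3P[_ p0N p0q].
rewrite (card_extensions_eq vs lts p0N p0q) natrM.
pose c : R := \prod_((size s).+1 <= k < J) rho k * #|extensions (rcons s p0)|%:R.
apply: (@le_trans _ _ (\sum_(p in legal s) c)).
  apply: ler_sum => p pL; have := pL; rewrite inE => /and3P[_ pN pq].
  apply: le_trans (IHi _ (valid_rcons vs pL) _) _.
    by rewrite size_rcons addSnnS.
  rewrite size_rcons ler_wpM2l ?prodr_ge0 // ler_nat.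
  exact: card_extensions_leq.
rewrite sumr_const -[c *+ _]mulr_natl.
have c_ge0 : 0 <= c by rewrite mulr_ge0 ?ler0n ?prodr_ge0.
apply: (@le_trans _ _ (rho (size s) * (#|H| - (size s).*2).-1%:R * c)).
  by rewrite ler_wpM2r // le_legal.
by rewrite /c -!mulrA [X in rho _ * X]mulrCA.
Qed.

End Exploration.

(** * Nonbacktracking walks *)

(* A half-edge is a vertex together with one of its [e + 2] slots; [sib h c] is the [c]-th
   of the other [e + 1] half-edges at the vertex of [h]. *)
Section Walks.
Variables (V : finType) (e : nat).
Notation H := (V * 'I_e.+2)%type.

Definition sib (h : H) (c : nat) : H := (h.1, lift h.2 (inord c : 'I_e.+1)).

Lemma sib_neq h c : sib h c != h.
Proof. by case: h => v i; rewrite xpair_eqE /= eq_sym (negPf (neq_lift _ _)) andbF. Qed.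

Lemma sib_inj h c c' : c < e.+1 -> c' < e.+1 -> sib h c = sib h c' -> c = c'.
Proof.
by move=> lc lc' /(congr1 snd)/lift_inj/(congr1 val); rewrite /= !inordK.
Qed.

Lemma sibP (h h' : H) : h'.1 = h.1 -> h' != h -> exists c : 'I_e.+1, h' = sib h c.
Proof.
case: h h' => [v i] [v' i'] /= ->; rewrite xpair_eqE eqxx eq_sym /= => /unlift_some[c -> _].
by exists c; rewrite /sib /= inord_val.
Qed.

Lemma card_halfedges_at (P : pred V) : #|[set h : H | P h.1]| = #|P| * e.+2.
Proof.
rewrite -[X in _ * X]card_ord -cardX; apply: eq_card => h.
by rewrite !inE /= andbT.
Qed.

Variable sg : H -> H.

Definition tgt (h : H) : V := (sg h).1.

Definition step : rel H := [rel h h' | (h'.1 == (sg h).1) && (h' != sg h)].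

(** Counting [h], the walk has at most [L] edges, and the list consists of its vertices. Walks that
    close up away from their starting vertex are excluded as well. *)
Definition good (L : nat) (h : H) : bool :=
  `[< forall p, path step h p -> size p < L -> uniq (h.1 :: map tgt (h :: p)) >].

Definition bad (L : nat) : {set H} := [set h | ~~ good L h].

(** Take the shortest prefix that repeats a vertex: only its last target is a repetition. *)
Lemma first_collision h p :
  path step h p -> ~~ uniq (h.1 :: map tgt (h :: p)) ->
  exists p', [/\ size p' <= size p, path step h p',
    uniq (h.1 :: map tgt (belast h p')) &
    tgt (last h p') \in h.1 :: map tgt (belast h p')].
Proof.
elim/last_ind: p => [|p x IHp].
  by move=> _; rewrite /= andbT negbK inE => hh; exists [::]; split=> //=; rewrite inE eq_sym.
rewrite rcons_path -rcons_cons map_rcons -rcons_cons rcons_uniq => /andP[hp stx].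
case Up: (uniq (h.1 :: map tgt (h :: p))); last first.
  by move=> _; have [p' [le ? ? ?]] := IHp hp (negbT Up); exists p'; rewrite size_rcons (leqW le).
rewrite andbT negbK => tx; exists (rcons p x).
by rewrite belast_rcons last_rcons rcons_path hp.
Qed.

(** A walk from [h] is determined by one sibling number per step, so at most [e.+1 ^ l] walks with
    [l] further steps have to be considered. *)
Lemma walk_codes h p : path step h p ->
  exists c : (size p).-tuple 'I_e.+1, forall k, k < size p ->
    nth h p k = sib (sg (nth h (h :: p) k)) (nth 0 (map val c) k).
Proof.
elim: p h => [|x p IHp] h; first by exists [tuple].
move=> /= /andP[/andP[/eqP x1 xN] /IHp[c cE]].
have [a xE] := sibP x1 xN.
exists [tuple of a :: c] => -[|k] //= ltk.
rewrite (set_nth_default x) // cE // ; congr (sib (sg _) _).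
by apply: set_nth_default; rewrite /= ltnW.
Qed.

End Walks.

(** * Expected number of bad half-edges *)

Section PathExploration.
Variables (V : finType) (e : nat).
Notation H := (V * 'I_e.+2)%type.
Variables (h : H) (c : seq nat).

(* Follows the walk from [h] that leaves each vertex by the sibling numbered by the next
   entry of [c]; it survives if it closes up exactly at its last step. *)
Definition path_qry (s : seq H) : H :=
  if s is [::] then h else sib (last h s) (nth 0 c (size s).-1).

Definition path_ok (s : seq H) : pred H :=
  fun p => (p.1 \in h.1 :: map fst s) == (size c <= size s).

Lemma path_qry1 s : (path_qry s).1 = last h.1 (map fst s).
Proof. by case: s => //= x s; rewrite last_map. Qed.

Lemma path_uniq s : valid path_qry path_ok s -> size s <= size c ->
  uniq (h.1 :: map fst s).
Proof.
elim=> // {}s p vs IHs; rewrite inE => /and3P[pok _ _].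
rewrite size_rcons map_rcons -rcons_cons rcons_uniq => lts.
rewrite (IHs (ltnW lts)) andbT; move: pok; rewrite /path_ok leqNgt lts /=.
by rewrite eqbF_neg.
Qed.

(** The query is at the vertex reached last, and the vertices visited are distinct. Only the last
    answer lies there too, and the query is a sibling of it. *)
Lemma path_fresh s : valid path_qry path_ok s -> size s < (size c).+1 ->
  path_qry s \notin revealed path_qry s.
Proof.
move=> vs les; have us := path_uniq vs les.
rewrite mem_cat negb_or; apply/andP; split.
  case/lastP: s us {vs les} => // s y us.
  have -> : path_qry (rcons s y) = sib y (nth 0 c (size s)).
    by case: s {us} => //= a s; rewrite last_rcons size_rcons.
  rewrite mem_rcons inE negb_or sib_neq /=.
  apply/negP=> /(map_f fst) /=; move: us.
  by rewrite map_rcons /= rcons_uniq mem_rcons => /and3P[_ /negPf->].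
apply/negP=> /mapP[i]; rewrite mem_iota /= add0n => lti /(congr1 fst).
rewrite !path_qry1 => E.
have E1 : nth h.1 (h.1 :: map fst s) (size s) = nth h.1 (h.1 :: map fst s) i.
  have -> : nth h.1 (h.1 :: map fst s) (size s) = last h.1 (map fst s).
    by rewrite (last_nth h.1) size_map.
  rewrite E (last_nth h.1) size_map size_takel ?(ltnW lti) //.
  case: i lti {E} => //= i lti; rewrite map_take nth_take //.
move/eqP: E1; rewrite nth_uniq //= ?size_map ?ltnS ?(ltnW lti) //.
by move/eqP=> E1; rewrite E1 ltnn in lti.
Qed.

Local Open Scope ring_scope.

(** Only the last step is improbable: its answer must be one of the [(size c).+1 * e.+2] half-edges
    at visited vertices, while at least half of all half-edges are still available. *)
Lemma card_path_survivors (R : realFieldType) : (4 * (size c).+1 <= #|{: H}|)%N ->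
  #|survivors path_qry path_ok (size c).+1|%:R
    <= (2 * (size c).+1 * e.+2)%:R / #|{: H}|%:R * #|pairings H|%:R :> R.
Proof.
move=> leN.
pose rho k : R := if (k < size c)%N then 1 else (2 * (size c).+1 * e.+2)%:R / #|{: H}|%:R.
have N0 : (0 < #|{: H}|)%N by apply: leq_trans leN; rewrite muln_gt0.
have := @card_survivors _ _ _ _ path_fresh R rho.
rewrite big_ord_recr /= big1 ?mul1r; last by move=> i _; rewrite /rho ltn_ord.
rewrite {3}/rho ltnn; apply.
  by move=> k; rewrite /rho; case: ifP => _ //; rewrite divr_ge0.
move=> s vs lts; rewrite /rho; case: ifP => ltsc.
  by rewrite mul1r ler_nat; apply: card_legal_leq vs lts; exact: path_fresh.
have sE : size s = size c by apply/eqP; rewrite eqn_leq -ltnS lts leqNgt ltsc.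
have le1 : (#|legal path_qry path_ok s| <= (size c).+1 * e.+2)%N.
  apply: (@leq_trans #|[set x : H | x.1 \in h.1 :: map fst s]|).
    apply/subset_leq_card/subsetP=> x; rewrite !inE => /andP[+ _].
    by rewrite /path_ok sE leqnn eqb_id inE.
  rewrite (card_halfedges_at _ (fun x => x \in h.1 :: map fst s)) leq_mul2r /=.
  by apply: leq_trans (card_size _) _; rewrite /= size_map sE.
have le2 : (#|{: H}| <= 2 * (#|{: H}| - (size s).*2).-1)%N.
  by rewrite sE; lia.
apply: le_trans (_ : ((size c).+1 * e.+2)%:R <= _); first by rewrite ler_nat.
rewrite mulrAC ler_pdivlMr ?ltr0n // -!natrM ler_nat.
by rewrite -(mulnA 2 _ e.+2) (mulnC 2) -(mulnA _ 2) leq_mul2l le2 orbT.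
Qed.

End PathExploration.

Section BadHalfEdges.
Variables (V : finType) (e : nat).
Notation H := (V * 'I_e.+2)%type.

Lemma answersE (qry : seq H -> H) (sg : H -> H) n (xs : seq H) h0 :
  size xs = n -> (forall k, k < n -> qry (map sg (take k xs)) = nth h0 xs k) ->
  forall k, k <= n -> answers qry sg k = map sg (take k xs).
Proof.
move=> szx qxs; elim=> [|k IHk] ltk; first by rewrite take0.
by rewrite /= IHk ?(ltnW ltk) // qxs // (take_nth h0) ?szx // map_rcons.
Qed.

Lemma bad_survives (sg : {perm H}) L h : sg \in pairings H -> h \in bad sg L ->
  exists (l : 'I_L) (c : l.-tuple 'I_e.+1),
    sg \in survivors (path_qry h (map val c)) (path_ok h (map val c)) l.+1.
Proof.
move=> sgP; rewrite inE => /asboolPn/existsNP[p].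
move=> /not_implyP[hp /not_implyP[ltp /negP/(first_collision hp)]].
case=> p' [lep hp' up' cp'].
have ltp' : size p' < L by apply: leq_ltn_trans ltp.
have [c cE] := walk_codes hp'.
exists (Ordinal ltp'), c; rewrite inE sgP /=; apply/forallP=> k.
(* The queries are the half-edges of the colliding walk, and the answers are their partners. *)
have qE j : j < (size p').+1 ->
    path_qry h (map val c) (map sg (take j (h :: p'))) = nth h (h :: p') j.
  case: j => //= j ltj; have lej : j <= size p' := ltnW ltj.
  rewrite cE // size_map size_takel // last_map; congr (sib (sg _) _).
  by rewrite (last_nth h) size_takel //; case: j {ltj} lej => //= j ltj; rewrite nth_take.
have aE := answersE (xs := h :: p') erefl qE.
have ltk := ltn_ord k.
rewrite aE ?(ltnW ltk) // qE // /path_ok !size_map size_take /= ltk size_tuple.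
have [lek|ltkp] := leqP (size p') k.
  have kE : nat_of_ord k = size p' by apply/eqP; rewrite eqn_leq lek -ltnS ltk.
  have tE : take k (h :: p') = belast h p'.
    by rewrite lastI kE -cats1 takel_cat ?size_belast // -(size_belast h p') take_size.
  rewrite tE -map_comp kE eqb_id.
  have -> : nth h (h :: p') (size p') = last h p' by rewrite (last_nth h).
  exact: cp'.
rewrite eqbF_neg -map_comp.
have : uniq (h.1 :: map (tgt sg) (take k.+1 (h :: p'))).
  move: up'; have -> : belast h p' = take (size p') (h :: p').
    by rewrite lastI -cats1 takel_cat ?size_belast // -(size_belast h p') take_size.
  move=> /(take_uniq k.+2) /=; rewrite -map_take take_takel //.
rewrite (take_nth h) 1?ltnW //  map_rcons -rcons_cons rcons_uniq => /andP[+ _].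
by [].
Qed.

Lemma sum_card_bad L :
  \sum_(sg in pairings H) #|bad sg L|
    <= \sum_(h : H) \sum_(l < L) \sum_(c : l.-tuple 'I_e.+1)
         #|survivors (path_qry h (map val c)) (path_ok h (map val c)) l.+1|.
Proof.
have -> : \sum_(sg in pairings H) #|bad sg L|
    = \sum_(h : H) \sum_(sg in pairings H) (h \in bad sg L).
  rewrite exchange_big /=; apply: eq_bigr => sg _.
  by rewrite -sum1_card big_mkcond; apply: eq_bigr => h _; case: (_ \in _).
apply: leq_sum => h _.
apply: (@leq_trans (\sum_(sg in pairings H) \sum_(l < L) \sum_(c : l.-tuple 'I_e.+1)
   (sg \in survivors (path_qry h (map val c)) (path_ok h (map val c)) l.+1))).
  apply: leq_sum => sg sgP; case hb: (h \in bad sg L) => //.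
  have [l [c sgs]] := bad_survives sgP hb.
  by rewrite (bigD1 l) //= (bigD1 c) //= sgs addn_gt0 addn_gt0.
rewrite exchange_big leq_sum // => l _; rewrite exchange_big leq_sum // => c _.
rewrite -sum1_card [leqRHS]big_mkcond [leqLHS]big_mkcond leq_sum // => sg _.
by case: (sg \in pairings H); case: (_ \in _).
Qed.

Local Open Scope ring_scope.

(** The number of choices of [h] cancels the denominator in [card_path_survivors], so the mean is
    bounded independently of the number of vertices. *)
Lemma sum_card_bad_leq (R : realFieldType) L : (4 * L <= #|{: H}|)%N ->
  (\sum_(sg in pairings H) #|bad sg L|)%:R
    <= (L * e.+1 ^ L * (2 * L * e.+2))%:R * #|pairings H|%:R :> R.
Proof.
move=> leN; apply: le_trans (_ : _ <= (\sum_(h : H) \sum_(l < L)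
  \sum_(c : l.-tuple 'I_e.+1) #|survivors (path_qry h (map val c)) (path_ok h (map val c)) l.+1|)%N%:R) _.
  by rewrite ler_nat sum_card_bad.
have [->|L_gt0] := posnP L.
  by rewrite big1 ?mulr_ge0 // => h _; rewrite big_ord0.
have N0 : (0 < #|{: H}|)%N by apply: leq_trans leN; rewrite muln_gt0.
pose q : R := (2 * L * e.+2)%:R / #|{: H}|%:R * #|pairings H|%:R.
have q_ge0 : 0 <= q by rewrite mulr_ge0 ?divr_ge0.
have le_c (h : H) (l : 'I_L) (c : l.-tuple 'I_e.+1) :
    #|survivors (path_qry h (map val c)) (path_ok h (map val c)) l.+1|%:R <= q.
  have sc : size (map val c) = l by rewrite size_map size_tuple.
  have := @card_path_survivors V e h (map val c) R; rewrite sc => le_s.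
  apply: le_trans (le_s _) _; first by rewrite (leq_trans _ leN) // leq_mul2l ltn_ord orbT.
  rewrite /q ler_wpM2r // ler_wpM2r ?invr_ge0 // ler_nat leq_mul2r leq_mul2l /=.
  exact: ltn_ord.
rewrite natr_sum; apply: (@le_trans _ _ (\sum_(h : H) (L * e.+1 ^ L)%:R * q)).
  apply: ler_sum => h _; rewrite natr_sum.
  apply: (@le_trans _ _ (\sum_(l < L) (e.+1 ^ L)%:R * q)); last first.
    by rewrite sumr_const card_ord natrM -mulrA -[leLHS]mulr_natl.
  apply: ler_sum => l _; rewrite natr_sum.
  apply: le_trans (ler_sum _ (fun c _ => le_c h l c)) _.
  rewrite sumr_const card_tuple card_ord -[q *+ _]mulr_natl ler_wpM2r // ler_nat.
  by rewrite leq_pexp2l // ltnW.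
rewrite sumr_const -[leLHS]mulr_natl /q le_eqVlt; apply/orP; left; apply/eqP.
rewrite [in RHS]natrM; field; by rewrite pnatr_eq0 -lt0n.
Qed.

End BadHalfEdges.

(** * The graph of a pairing *)

Lemma min_or_oo_leq (P : nat -> Prop) n : P n -> (min_or_oo P <= (Posz n)%:E)%E.
Proof.
move=> Pn; rewrite /min_or_oo; case: pselect => [exP|[]]; last by exists n; apply/asboolP.
by case: ex_minnP => k _ /(_ n); rewrite lee_fin lez_nat; apply; apply/asboolP.
Qed.

Lemma min_or_oo_geq (P : nat -> Prop) m :
  (forall n, P n -> m <= n) -> ((Posz m)%:E <= min_or_oo P)%E.
Proof.
move=> leP; rewrite /min_or_oo; case: pselect => [exP|_]; last exact: leey.
by rewrite lee_fin lez_nat; case: ex_minnP => k /asboolP/leP.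
Qed.

Section PairingGraph.
Variables (V : finType) (e : nat).
Notation H := (V * 'I_e.+2)%type.
Variables (sg : {perm H}) (L T : nat).
Hypotheses (sgP : sg \in pairings H) (L_gt0 : 0 < L).

Let sgK : involutive sg := pairingK sgP.

Lemma step_rev (a b : H) : step sg a b = step sg (sg b) (sg a).
Proof. by rewrite /step /= !sgK eq_sym [_ == b]eq_sym. Qed.

Lemma tgt_sg (h : H) : tgt sg (sg h) = h.1.
Proof. by rewrite /tgt sgK. Qed.

Definition clean (h : H) := good sg L h && good sg L (sg h).

Lemma clean_sg h : clean (sg h) = clean h.
Proof. by rewrite /clean sgK andbC. Qed.

Lemma good_uniq h p : good sg L h -> path (step sg) h p -> size p < L ->
  uniq (h.1 :: map (tgt sg) (h :: p)).
Proof. by move/asboolP; apply. Qed.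

(* The half-edges from which some walk of at most [i] further steps ends on an unclean
   half-edge. *)
Fixpoint reaching (i : nat) : {set H} :=
  let X := [set h | ~~ clean h] in
  if i is i'.+1 then X :|: [set h | [exists c : 'I_e.+1, sib (sg h) c \in reaching i']]
  else X.

(** Unclean edges will be deleted. Within [T] steps of a deep edge nothing is deleted, so walks of
    the pairing there are walks of the graph. *)
Definition deep (h : H) := (h \notin reaching T) && (sg h \notin reaching T).

Lemma card_unclean : #|[set h | ~~ clean h]| <= 2 * #|bad sg L|.
Proof.
apply: (@leq_trans #|bad sg L :|: sg @: bad sg L|).
  apply/subset_leq_card/subsetP=> h; rewrite !inE negb_and => /orP[->//|bh].
  by apply/orP; right; apply/imsetP; exists (sg h); rewrite ?inE ?sgK.
by rewrite (leq_trans (leq_card_setU _ _)) // mul2n -addnn leq_add2l leq_imset_card.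
Qed.

(** A half-edge can be entered from at most [e.+2] others, namely the partners of the half-edges at
    its vertex. *)
Lemma card_reaching i : #|reaching i| <= (e.+3) ^ i * #|[set h | ~~ clean h]|.
Proof.
elim: i => [|i IHi] /=; first by rewrite mul1n.
apply: leq_trans (leq_card_setU _ _) _.
rewrite expnS -mulnA [leqRHS]mulSn leq_add ?leq_pmull ?expn_gt0 //.
apply: (@leq_trans (e.+2 * #|reaching i|)); last by rewrite leq_mul2l IHi orbT.
rewrite mulnC -[X in _ * X]card_ord -cardsT -cardsX.
apply: leq_trans (leq_imset_card (fun x : H * 'I_e.+2 => sg (x.1.1, x.2)) _).
apply/subset_leq_card/subsetP=> h; rewrite inE => /existsP[c hc].
apply/imsetP; exists (sib (sg h) c, (sg h).2); first by rewrite !inE hc.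
by rewrite /= -surjective_pairing sgK.
Qed.

Lemma reaching_mono i j h : i <= j -> h \in reaching i -> h \in reaching j.
Proof.
elim: j i h => [|j IHj] [|i] h //= lij; rewrite !inE; first by move=> ->.
case/orP=> [->//|/existsP[c hc]]; apply/orP; right; apply/existsP; exists c.
exact: IHj hc.
Qed.

Lemma reachingP h p : path (step sg) h p -> ~~ clean (last h p) -> h \in reaching (size p).
Proof.
elim: p h => [|x p IHp] h /=; first by rewrite inE.
case/andP=> /andP[/eqP x1 xN] hp cl; rewrite !inE; apply/orP; right; apply/existsP.
by have [c xE] := sibP x1 xN; exists c; rewrite -xE IHp.
Qed.

Lemma card_not_deep : #|[set h | ~~ deep h]| <= 4 * e.+3 ^ T * #|bad sg L|.
Proof.
apply: (@leq_trans #|reaching T :|: sg @: reaching T|).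
  apply/subset_leq_card/subsetP=> h; rewrite !inE negb_and !negbK => /orP[->//|bh].
  by apply/orP; right; apply/imsetP; exists (sg h); rewrite ?inE ?sgK.
apply: leq_trans (leq_card_setU _ _) _.
apply: leq_trans (leq_add (leqnn _) (leq_imset_card _ _)) _.
have : #|reaching T| <= e.+3 ^ T * (2 * #|bad sg L|).
  by rewrite (leq_trans (card_reaching T)) // leq_mul2l card_unclean orbT.
nia.
Qed.

Lemma deep_sg h : deep (sg h) = deep h.
Proof. by rewrite /deep sgK andbC. Qed.

Lemma deep_clean h p : deep h -> path (step sg) h p -> size p <= T -> clean (last h p).
Proof.
case/andP=> hN _ hp lep; apply: contraR hN => /(reachingP hp).
exact: reaching_mono.
Qed.

(* Reversing the first walk and continuing along the second one closes a loop. *)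
Lemma loop_free x p p' : path (step sg) x p -> path (step sg) (sg x) p' ->
  tgt sg (last x p) = tgt sg (last (sg x) p') -> good sg L (sg (last x p)) ->
  size p + size p' < L -> False.
Proof.
move=> xp xp' E gd ltL.
pose w := rev (belast (sg x) (map sg p)) ++ p'.
have hw : path (step sg) (sg (last x p)) w.
  rewrite cat_path -last_map rev_path.
  have -> : last (last (sg x) (map sg p)) (rev (belast (sg x) (map sg p))) = sg x.
    by case: p {xp E gd ltL w} => //= y p; rewrite rev_cons last_rcons.
  rewrite xp' andbT (map_path (b := pred0) (e' := step sg)) //; last first.
    exact/hasPn.
  by move=> a b _; rewrite /= [RHS]step_rev.
have := good_uniq gd hw; rewrite size_cat size_rev size_belast size_map => /(_ ltL).
rewrite /= => /andP[/negP + _]; apply.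
have -> : (sg (last x p)).1 = tgt sg (last (sg (last x p)) w).
  rewrite last_cat.
  have -> : last (sg (last x p)) (rev (belast (sg x) (map sg p))) = sg x.
    by case: p {xp E gd ltL w hw} => //= y p; rewrite rev_cons last_rcons.
  by rewrite -E.
by rewrite -map_cons map_f // mem_last.
Qed.

(** Strip the common first steps. If one walk is then exhausted, the other returns to a visited
    vertex; if they diverge, [loop_free] applies at the fork. *)
Lemma walk_inj x p p' : path (step sg) x p -> path (step sg) x p' ->
  size p + size p' < L ->
  (forall q, path (step sg) x q -> size q <= maxn (size p) (size p') -> clean (last x q)) ->
  tgt sg (last x p) = tgt sg (last x p') -> last x p = last x p'.
Proof.
elim: p x p' => [|a p IHp] x [|a' p'] //=.
- move=> _ xp ltL cl E; have /andP[gx _] := cl [::] isT isT.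
  have := good_uniq (h := x) (p := a' :: p') gx xp ltL; rewrite /= => /and3P[_ /negP[]].
  by rewrite E -map_cons map_f // mem_last.
- move=> xp _ ltL cl E; have /andP[gx _] := cl [::] isT isT.
  have := good_uniq (h := x) (p := a :: p) gx xp; rewrite addn0 in ltL.
  rewrite /= => /(_ ltL) /and3P[_ /negP[]].
  by rewrite -E -map_cons map_f // mem_last.
move=> xp xp' ltL cl E; have [eqa|neqa] := eqVneq a a'.
  subst a'; apply: IHp => //; try lia; try by [move: xp => /andP[]|move: xp' => /andP[]].
  move=> q aq szq; apply: (cl (a :: q)) => /=; last by lia.
  by move: xp => /andP[-> _].
have /andP[_ gd] := cl (a :: p) xp (leq_maxl _ _).
move: xp xp' => /andP[/andP[/eqP a1 aN] ap] /andP[/andP[/eqP a1' aN'] ap'].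
case: (@loop_free a p (a' :: p')) => //=; last by lia.
by rewrite ap' andbT /step /= sgK a1 a1' eqxx eq_sym.
Qed.

(** Walks leaving the edge on the same side fall under [walk_inj]; on opposite sides they form a
    single walk across the edge, which [loop_free] excludes. *)
Lemma walk_end_inj rho x x' p p' : deep rho ->
  x \in [:: rho; sg rho] -> x' \in [:: rho; sg rho] ->
  path (step sg) x p -> path (step sg) x' p' -> size p <= T -> size p' <= T ->
  size p + size p' < L ->
  tgt sg (last x p) = tgt sg (last x' p') -> last x p = last x' p'.
Proof.
move=> dr xr xr' xp xp' leT leT' ltL E.
have dx : deep x by move: xr; rewrite !inE => /orP[] /eqP-> //; rewrite deep_sg.
have [ex|nx] := eqVneq x x'.
  subst x'; apply: walk_inj E => // q xq szq; apply: deep_clean => //.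
  by rewrite (leq_trans szq) // geq_max leT.
have ex : x' = sg x.
  move: xr xr' nx; rewrite !inE => /orP[] /eqP-> /orP[] /eqP->; rewrite ?eqxx ?sgK //.
subst x'; have /andP[_ gd] := deep_clean dx xp leT.
by case: (loop_free xp xp' E gd ltL).
Qed.

Definition padj (u v : V) := [exists h : H, [&& clean h, h.1 == u & tgt sg h == v]].

Lemma padj_tgt h : clean h -> padj h.1 (tgt sg h).
Proof. by move=> ch; apply/existsP; exists h; rewrite ch !eqxx. Qed.

Lemma padj_sym : symmetric padj.
Proof.
suff imp u v : padj u v -> padj v u by move=> u v; apply/idP/idP; exact: imp.
case/existsP=> h /and3P[ch /eqP <- /eqP <-].
by rewrite -(tgt_sg h); apply: padj_tgt; rewrite clean_sg.
Qed.

Lemma padj_irrefl : irreflexive padj.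
Proof.
move=> u; apply/negbTE/existsPn=> h; apply/negP=> /and3P[/andP[gh _] /eqP <- /eqP E].
by have := good_uniq (p := [::]) gh isT L_gt0; rewrite /= E inE eqxx.
Qed.

Definition pgraph : sgraph := SGraph padj_sym padj_irrefl.

Lemma max_degree_pgraph : max_degree pgraph <= e.+2.
Proof.
apply/bigmax_leqP=> v _.
rewrite -[leqRHS]card_ord -cardsT.
apply: leq_trans (leq_imset_card (fun i : 'I_e.+2 => tgt sg (v, i)) _).
apply/subset_leq_card/subsetP=> w; rewrite inE => /existsP[[u i]] /and3P[_ /= /eqP<- /eqP<-].
by apply/imsetP; exists i.
Qed.

(** Each step lifts to a clean half-edge; since vertices two apart differ, no lifted step turns back
    along the previous edge. *)
Lemma padj_walk u q : path padj u q -> q != [::] ->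
  (forall i, i.+2 <= size q -> nth u (u :: q) i != nth u (u :: q) i.+2) ->
  exists h p, [/\ clean h, h.1 = u, map (tgt sg) (h :: p) = q & path (step sg) h p].
Proof.
elim: q u => [|v [|w q] IHq] u //=.
  rewrite andbT => /existsP[h /and3P[ch /eqP hu /eqP hv]] _ _.
  by exists h, [::]; rewrite /= hv.
case/andP=> /existsP[h /and3P[ch /eqP hu /eqP hv]] vq _ neq.
have [//|//|i lti|h' [p [ch' h'v [h'w pq] h'p]]] := IHq v.
  have := neq i.+1 lti; rewrite /= => neqi.
  rewrite (set_nth_default u) 1?[X in _ != X](set_nth_default u) //= ?ltnS 1?ltnW //.
  by rewrite ltnW.
exists h, (h' :: p); split=> //; first by rewrite /= hv h'w pq.
rewrite /= h'p andbT /step /= h'v -hv eqxx /=.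
by apply: contraNneq (neq 0 isT) => /= h'E; rewrite -hu -h'w h'E tgt_sg.
Qed.

Lemma girth_pgraph g : g <= L -> ((Posz g)%:E <= girth pgraph)%E.
Proof.
move=> leg; apply: min_or_oo_geq => n [c [[/andP[cyc Uc] gt2] <-]].
rewrite leqNgt; apply/negP=> ltg.
case: c cyc Uc gt2 ltg => //= x c cyc Uc gt2 ltg.
have [| |h [p [/andP[gh _] hx pE hp]]] := padj_walk cyc; first by case: (c).
  move=> i; rewrite size_rcons => lti.
  have nE j : j <= size c -> nth x (x :: rcons c x) j = nth x (x :: c) j.
    by move=> lej; rewrite -rcons_cons nth_rcons /= ltnS lej.
  have [leic|gtic] := leqP i.+2 (size c).
    rewrite !nE //; last by rewrite ltnW // ltnW.
    by rewrite nth_uniq //= ?ltnS //; lia.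
  (* The last entry of [rcons c x] is the start [x] again, at position 0 of the cycle, so it must be
     compared with position [i] separately. *)
  have iE : i.+2 = (size c).+1 by lia.
  rewrite nE; last by lia.
  rewrite iE -rcons_cons nth_rcons /= ltnn eqxx -[X in _ != X]/(nth x (x :: c) 0).
  by rewrite nth_uniq //= ?ltnS //; lia.
have szp : size p = size c by have := congr1 size pE; rewrite /= size_map size_rcons => -[].
have := good_uniq gh hp; rewrite pE hx szp => /(_ (leq_trans (ltnW ltg) leg)).
by rewrite /= mem_rcons inE eqxx.
Qed.

Definition hedge (h : H) : {set pgraph} := [set h.1; tgt sg h].

Lemma hedge_edges h : clean h -> hedge h \in edges pgraph.
Proof.
move=> ch; rewrite inE; apply/existsP; exists h.1; apply/existsP; exists (tgt sg h).
by rewrite eqxx andbT; apply: padj_tgt.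
Qed.

(* [v] is at distance at most [i] from an end of the edge of [rho] (the walk [[:: sg rho]]
   ends at the initial vertex of [rho]). *)
Definition near (rho : H) (i : nat) (v : V) : Prop :=
  exists x p, [/\ x \in [:: rho; sg rho], path (step sg) x p, size p <= i & tgt sg (last x p) = v].

Lemma near_path rho i v : deep rho -> near rho i v -> i <= T ->
  exists x q, [/\ x \in hedge rho, path padj x q, size q <= i & last x q = v].
Proof.
move=> dr [x [p [xr xp szp <-]]] leT; exists (tgt sg x), (map (tgt sg) p).
rewrite size_map last_map; split=> //.
  move: xr; rewrite !inE => /orP[] /eqP->; first by rewrite eqxx orbT.
  by rewrite tgt_sg eqxx.
have dx : deep x by move: xr; rewrite !inE => /orP[] /eqP-> //; rewrite deep_sg.
have {leT} : size p <= T by apply: leq_trans leT.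
elim/last_ind: p xp {szp} => // p y IHp; rewrite rcons_path map_rcons rcons_path size_rcons.
case/andP=> xp ly leT; rewrite IHp ?(ltnW leT) // last_map.
have /andP[/eqP y1 _] := ly.
have -> : tgt sg (last x p) = y.1 by [].
apply: padj_tgt; have := @deep_clean x (rcons p y) dx.
by rewrite last_rcons; apply; rewrite ?size_rcons // rcons_path xp.
Qed.

(** One path followed by the reverse of the other has at most [i + j + 1] vertices; as [edge_dist]
    counts vertices, the hypothesis is the strict [i + j < t]. *)
Lemma near_edge_dist rho rho' i j t v : deep rho -> deep rho' -> i <= T -> j <= T ->
  near rho i v -> near rho' j v -> i + j < t ->
  (edge_dist (hedge rho) (hedge rho') <= (Posz t)%:E)%E.
Proof.
move=> dr dr' leiT lejT /(near_path dr)/(_ leiT)[x [q [xr xq szq qv]]].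
case/(near_path dr')/(_ lejT)=> x' [q' [xr' xq' szq' qv']] ltt.
pose w := q ++ rev (belast x' q').
have hw : path padj x w.
  rewrite cat_path xq qv -qv' rev_path; apply: sub_path xq' => a b.
  by rewrite /= padj_sym.
have lw : last x w = x'.
  rewrite last_cat qv -qv'; case: (q') => //= y r; by rewrite rev_cons last_rcons.
have szw : size w <= i + j by rewrite size_cat size_rev size_belast leq_add.
case: (shortenP hw) lw => w' hw' Uw' sw' lw'.
apply: (@le_trans _ _ (Posz (size (x :: w')))%:E).
  by apply: min_or_oo_leq; exists x, w'; split=> //; split=> //; rewrite lw'.
rewrite lee_fin lez_nat; apply: leq_ltn_trans ltt; apply: leq_trans szw.
apply: uniq_leq_size => //; by move: Uw' => /andP[].
Qed.

(** A parallel edge would close a walk of two edges starting with [h]. *)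
Lemma hedge_inj h h' : 1 < L -> clean h -> hedge h = hedge h' -> h' = h \/ h' = sg h.
Proof.
move=> L2 /andP[gh gh'] E.
have hN : h.1 != tgt sg h.
  by have := good_uniq (p := [::]) gh isT L_gt0; rewrite /= inE andbT.
have h1 : h'.1 \in hedge h by rewrite E !inE eqxx.
have h3 : h.1 \in hedge h' by rewrite -E !inE eqxx.
have h4 : tgt sg h \in hedge h' by rewrite -E !inE eqxx orbT.
have main (y x : H) : good sg L y -> x.1 = y.1 -> tgt sg x = tgt sg y -> x = y.
  move=> g x1 x2; apply/eqP; apply: contraT => xN.
  have := @good_uniq y [:: sg x] g; rewrite /= andbT => /(_ _ L2).
  rewrite tgt_sg x1 !inE eqxx orbT; apply.
  by rewrite /step /= -/(tgt sg x) x2 eqxx (inj_eq perm_inj).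
move: h1; rewrite !inE => /orP[] /eqP h'1.
  left; apply: main => //; move: h4; rewrite !inE h'1 => /orP[|/eqP//].
  by rewrite eq_sym (negPf hN).
right; apply: main => //; rewrite tgt_sg.
by move: h3; rewrite !inE h'1 (negPf hN) => /eqP.
Qed.

End PairingGraph.

(** Serves where the lower bound required of the chromatic index is 0. *)
Lemma edgeless_graph (g D : nat) : exists G : sgraph,
  ((Posz g)%:E <= girth G)%E /\ max_degree G <= D.
Proof.
pose G := @SGraph unit (fun _ _ => false) (fun _ _ => erefl) (fun _ => erefl).
exists G; split.
  apply: min_or_oo_geq => n [c [[/andP[+ _] +] _]].
  by case: c => [|x [|y c]].
by apply/bigmax_leqP=> v _; rewrite eq_card0 // => w; rewrite inE.
Qed.

(** * Exploring balls around given edges *)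

Section BallExploration.
Variables (V : finType) (e : nat).
Notation H := (V * 'I_e.+2)%type.
Variables (h0 : H) (M : seq H) (W : nat).
Notation m := (size M).

(* Breadth-first order: with [M] the half-edges of the given edges and [s] the answers, the
   vertices seen are those of [M ++ s], so the first [m] queries reveal the other ends, and
   then the [e + 1] remaining half-edges of each seen vertex are queried in turn. Only the
   first [W] vertices seen are recorded: after that, answers must merely avoid them. *)
Definition origin_index (k : nat) : nat := if k < m then k else (k - m) %/ e.+1.

Definition ball_qry (s : seq H) : H :=
  let k := size s in let h := nth h0 (M ++ s) (origin_index k) in
  if k < m then h else sib h ((k - m) %% e.+1).

Definition seen (s : seq H) : seq H := take W (M ++ s).

Definition ball_ok (s : seq H) : pred H := fun p => p.1 \notin map fst (seen s).

Variable J : nat.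
Hypotheses (m_gt0 : 0 < m) (leMW : m <= W) (leJW : J <= m + e.+1 * W)
  (UM : uniq (map fst M)).

Let valid_ball := valid ball_qry ball_ok.

Lemma ball_qry1 s : (ball_qry s).1 = (nth h0 (M ++ s) (origin_index (size s))).1.
Proof. by rewrite /ball_qry; case: ifP. Qed.

Lemma origin_index_lt k : origin_index k < m + k.
Proof.
rewrite /origin_index; case: (ltnP k m) => ltk; first by lia.
rewrite (@leq_ltn_trans (k - m)) ?leq_div //; lia.
Qed.

(** This is the purpose of [leJW]: with [e.+1] queries per recorded vertex after the first [m], all
    queries are made at recorded vertices. *)
Lemma origin_index_ltW k : k < J -> origin_index k < W.
Proof.
move=> ltk; rewrite /origin_index; case: (ltnP k m) => ltkm; first by lia.
by rewrite ltn_divLR //; nia.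
Qed.

Lemma seen_rcons s p : W <= m + size s -> seen (rcons s p) = seen s.
Proof. by move=> leW; rewrite /seen -cats1 catA takel_cat // size_cat. Qed.

Lemma seen_rconsS s p : m + size s < W -> seen (rcons s p) = rcons (seen s) p.
Proof.
move=> ltW; rewrite /seen -rcons_cat !take_oversize // ?size_rcons size_cat //.
exact: ltnW.
Qed.

Lemma seen_uniq s : valid_ball s -> uniq (map fst (seen s)).
Proof.
elim=> [|{}s p vs IHs]; first by rewrite /seen cats0 map_take take_uniq.
rewrite inE => /and3P[okp _ _]; have [leW|ltW] := leqP W (m + size s).
  by rewrite seen_rcons.
by rewrite seen_rconsS // map_rcons rcons_uniq IHs andbT.
Qed.

Lemma late_unseen s x : valid_ball s -> x \in drop (W - m) s -> x.1 \notin map fst (seen s).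
Proof.
elim=> // {}s p vs IHs; rewrite inE => /and3P[okp _ _].
have [leW|ltW] := leqP W (m + size s); last first.
  by rewrite drop_oversize // size_rcons; lia.
rewrite seen_rcons // drop_rcons; last by lia.
by rewrite mem_rcons inE => /orP[/eqP->|/IHs].
Qed.

Lemma size_seen s : size (seen s) = minn (m + size s) W.
Proof. by rewrite size_take size_cat minnC /minn. Qed.

Lemma nth_seen s i : i < W -> nth h0 (seen s) i = nth h0 (M ++ s) i.
Proof. by move=> iW; rewrite nth_take. Qed.

Lemma nth_seen_inj s i j : valid_ball s -> i < minn (m + size s) W -> j < minn (m + size s) W ->
  (nth h0 (M ++ s) i).1 = (nth h0 (M ++ s) j).1 -> i = j.
Proof.
move=> vs lti ltj; have := seen_uniq vs => us.
have [iW jW] : i < W /\ j < W by move: lti ltj; rewrite !leq_min; lia.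
rewrite -!nth_seen // -!(nth_map h0 h0.1 fst) ?size_seen // => /eqP.
by rewrite nth_uniq ?size_map ?size_seen // => /eqP.
Qed.

Lemma ball_qry_seen s : size s < J -> (ball_qry s).1 \in map fst (seen s).
Proof.
move=> ltk; rewrite ball_qry1 -nth_seen ?origin_index_ltW //.
by rewrite map_f // mem_nth // size_seen leq_min origin_index_lt origin_index_ltW.
Qed.

(** Queries are at recorded vertices, which late answers avoid. An early answer at such a vertex is
    its origin, whose siblings are the ones queried; and two queries at one vertex differ in the
    sibling number, or one of them is the given half-edge itself. *)
Lemma ball_fresh s : valid_ball s -> size s < J -> ball_qry s \notin revealed ball_qry s.
Proof.
move=> vs ltk; set k := size s in ltk *.
have aW := origin_index_ltW ltk; have am := origin_index_lt k.
rewrite mem_cat negb_or; apply/andP; split; apply/negP.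
  move=> qs; have qi : index (ball_qry s) s < k by rewrite index_mem.
  set i := index _ _ in qi; have qE : nth h0 s i = ball_qry s by rewrite nth_index.
  have [leW|ltW] := leqP W (m + i).
    have : ball_qry s \in drop (W - m) s.
      have leWi : W - m <= i by lia.
      by rewrite -qE -{1}(subnKC leWi) -nth_drop mem_nth // size_drop -/k; lia.
    by move/(late_unseen vs); rewrite ball_qry_seen.
  have iE : nth h0 (M ++ s) (m + i) = ball_qry s.
    by rewrite nth_cat ltnNge leq_addr /= addKn.
  have := congr1 fst iE; rewrite ball_qry1.
  move/(nth_seen_inj vs) => /(_ _ _)/[dup]; rewrite !leq_min ltW am aW ltn_add2l qi => /(_ isT isT) aE _.
  move: iE; rewrite /ball_qry -/k -aE; case: ifP => [ltkm|_].
    by move: aE; rewrite /origin_index -/k ltkm /= => aE; move: ltkm; rewrite -aE ltnNge leq_addr.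
  by move/eqP; rewrite eq_sym (negPf (sib_neq _ _)).
case/mapP=> i; rewrite mem_iota /= add0n => lti qE.
have szi : size (take i s) = i by rewrite size_takel // ltnW.
have ltiJ : i < J by apply: ltn_trans ltk.
have aiW := origin_index_ltW ltiJ; have aim := origin_index_lt i.
have nE : nth h0 (M ++ take i s) (origin_index i) = nth h0 (M ++ s) (origin_index i).
  by rewrite -[in RHS](cat_take_drop i s) catA [in RHS]nth_cat size_cat szi aim.
have := congr1 fst qE; rewrite !ball_qry1 szi nE.
move/(nth_seen_inj vs); rewrite !leq_min am aW aiW (leq_trans aim) ?leq_add2l 1?ltnW //=.
move=> /(_ isT isT) aE.
move: qE; rewrite /ball_qry szi nE aE -/k; move: aE; rewrite /origin_index.
case: ifP => ltim; case: ifP => ltkm aE.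
- by move=> _; rewrite aE ltnn in lti.
- by move/eqP; rewrite eq_sym (negPf (sib_neq _ _)).
- by move/eqP; rewrite (negPf (sib_neq _ _)).
move/sib_inj; rewrite !ltn_mod => /(_ isT isT) mE.
rewrite -/k in lti aE; have := divn_eq (i - m) e.+1; rewrite -aE -mE -divn_eq; lia.
Qed.

(* Lower bound for the number of unrevealed half-edges at seen vertices, other than the
   queried one: up to [W] vertices are seen, each step reveals one query at them, and the
   first [W - m] answers are at them too. *)
Definition blocked (k : nat) : nat := e.+2 * minn (m + k) W - k - minn k (W - m) - 1.

Lemma card_ball_legal s : valid_ball s -> size s < J ->
  #|legal ball_qry ball_ok s| + blocked (size s) <= (#|{: H}| - (size s).*2).-1.
Proof.
move=> vs lts; rewrite -(card_unqueried ball_fresh vs lts).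
set U := [set p | _]; pose D := [set p : H | p.1 \in map fst (seen s)].
have le1 : #|legal ball_qry ball_ok s| <= #|U :\: D|.
  apply/subset_leq_card/subsetP=> p; rewrite !inE => /and3P[okp pN pq].
  by rewrite pN pq !andbT; exact: okp.
have cD : #|D| = e.+2 * minn (m + size s) W.
  rewrite (card_halfedges_at _ (fun v => v \in map fst (seen s))) mulnC.
  by rewrite (card_uniqP (seen_uniq vs)) size_map size_seen.
(* The half-edges at seen vertices that are no longer available are the current query, earlier
   queries, and the first [W - m] answers. *)
have le2 : #|D :\: U| <= 1 + size s + minn (size s) (W - m).
  pose X := ball_qry s :: [seq ball_qry (take i s) | i <- iota 0 (size s)] ++ take (W - m) s.
  have -> : 1 + size s + minn (size s) (W - m) = size X.
    by rewrite /= size_cat size_map size_iota size_take minnC /minn add1n.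
  apply: leq_trans (card_size X); apply/subset_leq_card/subsetP=> p.
  rewrite !inE negb_and !negbK => /andP[/orP[pr|->//] pD]; apply/orP; right.
  move: pr; rewrite /revealed -{1}(cat_take_drop (W - m) s) !mem_cat => /orP[/orP[->|pd]|->//].
    by rewrite orbT.
  by have := late_unseen vs pd; rewrite pD.
have := cardsID D U; have := cardsID U D; rewrite setIC cD /blocked; lia.
Qed.

Local Open Scope ring_scope.

(** Of at most [N] available answers, [blocked k] are forbidden, so step [k] survives with
    probability at most [1 - blocked k / N], which is at most [exp (- blocked k / N)]. *)
Lemma card_ball_survivors (R : realType) :
  #|survivors ball_qry ball_ok J|%:R
    <= expR (- (\sum_(k < J) blocked k)%:R / #|{: H}|%:R) * #|pairings H|%:R :> R.
Proof.
pose rho k : R := expR (- (blocked k)%:R / #|{: H}|%:R).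
have N0 : (0 < #|{: H}|)%N by apply/card_gt0P; exists h0.
have := @card_survivors _ _ _ _ ball_fresh R rho.
have -> : \prod_(k < J) rho k = expR (- (\sum_(k < J) blocked k)%:R / #|{: H}|%:R).
  by rewrite natr_sum -sumrN mulr_suml expR_sum.
apply; first by move=> k; exact: expR_ge0.
move=> s vs lts; have le := card_ball_legal vs lts.
set b := (_ - _).-1 in le *.
apply: (@le_trans _ _ ((1 - (blocked (size s))%:R / #|{: H}|%:R) * b%:R)); last first.
  by apply: ler_wpM2r => //; rewrite /rho mulNr; exact: expR_ge1Dx.
have leb : b%:R <= #|{: H}|%:R :> R by rewrite ler_nat /b; lia.
have N0R : 0 < #|{: H}|%:R :> R by rewrite ltr0n.
apply: (@le_trans _ _ (b%:R - (blocked (size s))%:R)).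
  by rewrite lerBrDr -natrD ler_nat.
rewrite mulrBl mul1r lerD2l lerN2 mulrAC ler_pdivrMr //.
exact: ler_wpM2l.
Qed.

End BallExploration.

(* The number of vertices within distance [l] of [m] edges with disjoint tree-like balls. *)
Fixpoint ball_volume (e m l : nat) : nat :=
  if l is l'.+1 then 2 * m + e.+1 * ball_volume e m l' else 2 * m.

Lemma ball_volume_mono e m l r : l <= r -> ball_volume e m l <= ball_volume e m r.
Proof.
elim: r l => [|r IHr] [|l] //= lelr; first by rewrite leq_addr.
by rewrite leq_add2l leq_mul2l IHr.
Qed.

Lemma ball_volume_ge e m l : 2 * m <= ball_volume e m l.
Proof. by case: l => //= l; rewrite leq_addr. Qed.

Lemma nth_answers (T : finType) (qry : seq T -> T) (f : T -> T) x0 j k : j < k ->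
  nth x0 (answers qry f k) j = f (qry (answers qry f j)).
Proof.
elim: k => // k IHk; rewrite ltnS leq_eqVlt => /orP[/eqP->|ltjk] /=.
  by rewrite nth_rcons size_answers ltnn eqxx.
by rewrite nth_rcons size_answers ltjk IHk.
Qed.

Lemma take_answers (T : finType) (qry : seq T -> T) (f : T -> T) j k : j <= k ->
  take j (answers qry f k) = answers qry f j.
Proof.
elim: k => [|k IHk]; first by rewrite leqn0 => /eqP->.
rewrite leq_eqVlt ltnS => /orP[/eqP->|lejk].
  by rewrite take_oversize // size_answers.
by rewrite /= -cats1 takel_cat ?size_answers // IHk.
Qed.

(** * Families of distant edges survive the ball exploration *)

Section Apart.
Variables (V : finType) (e : nat).
Notation H := (V * 'I_e.+2)%type.
Variables (sg : {perm H}) (T t : nat).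
Hypothesis sgP : sg \in pairings H.

Lemma near0 (rho : H) : near sg rho 0 rho.1 /\ near sg rho 0 (tgt sg rho).
Proof.
split; last by exists rho, [::]; rewrite inE eqxx.
by exists (sg rho), [::]; rewrite !inE eqxx orbT tgt_sg.
Qed.

(** Nearness refers to the whole pairing before deletion, which is what the exploration reveals. *)
Definition apart (M : {pred H}) := forall rho rho' i j v, rho \in M -> rho' \in M ->
  rho != rho' -> i <= T -> j <= T -> near sg rho i v -> near sg rho' j v -> t <= i + j.

Lemma apart_fst_inj (M : {pred H}) : 0 < t -> apart M -> {in M &, injective fst}.
Proof.
move=> t_gt0 apM rho rho' rM rM' E; apply/eqP; apply: contraTT t_gt0 => rN.
have [n1 _] := near0 rho; have [n2 _] := near0 rho'; rewrite -E in n2.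
by rewrite -leqNgt; apply: apM rM rM' rN (leq0n T) (leq0n T) n1 n2.
Qed.

End Apart.

Section BallSurvival.
Variables (V : finType) (e : nat).
Notation H := (V * 'I_e.+2)%type.
Variables (sg : {perm H}) (L T t l r : nat) (h0 : H) (M : seq H).
Notation m := (size M).
Notation vol := (ball_volume e m).
Notation W := (vol r).
Notation qry := (ball_qry h0 M).
Notation ok := (ball_ok M W).
Notation J := (m + e.+1 * vol l).
Hypotheses (sgP : sg \in pairings H) (m_gt0 : 0 < m).
Let sgK : involutive sg := pairingK sgP.

(** The [a]-th vertex in breadth-first order lies within distance [i] of a given edge: past the ends
    of these edges, it was reached from vertex [(a - 2 m) / (e + 1)], whose number is below the
    volume for [i - 1]. *)
Lemma origin_walk i k a : a < vol i -> a < m + k ->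
  exists rho x p, [/\ rho \in M, x \in [:: rho; sg rho], path (step sg) x p,
    size p <= i & last x p = sg (nth h0 (M ++ answers qry sg k) a)].
Proof.
elim: i k a => [|i IHi] k a lta ltk.
all: have [ltam|leam] := ltnP a m;
  first by exists (nth h0 M a), (sg (nth h0 M a)), [::];
  rewrite mem_nth // !inE eqxx orbT nth_cat ltam.
all: have aE : nth h0 (M ++ answers qry sg k) a = sg (qry (answers qry sg (a - m)))
  by rewrite nth_cat ltnNge leam /= nth_answers //; lia.
all: have [ltam2|leam2] := ltnP (a - m) m;
  first by exists (nth h0 M (a - m)), (nth h0 M (a - m)), [::];
  rewrite mem_nth // !inE eqxx aE sgK /ball_qry /origin_index size_answers ltam2 nth_cat ltam2.
  by move: lta => /=; lia.
pose b := (a - m - m) %/ e.+1.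
have ltb : b < vol i by rewrite ltn_divLR //; move: lta => /=; lia.
have ltbm : b < m + (a - m).
  by apply: leq_ltn_trans (leq_div _ _) _; lia.
have [rho [x [p [rM xr xp szp lp]]]] := IHi (a - m) b ltb ltbm.
exists rho, x, (rcons p (qry (answers qry sg (a - m)))).
rewrite size_rcons last_rcons aE sgK; split=> //.
rewrite rcons_path xp /= lp /step /= sgK.
rewrite /ball_qry /origin_index size_answers ltnNge leam2 /= -/b.
by rewrite eqxx sib_neq.
Qed.

Hypotheses (ltlT : l < T) (lerT : r <= T) (ltlrL : l.+1 + r < L) (ltlrt : l.+1 + r < t)
  (lelr : l <= r) (uniqM : uniq M)
  (deepM : forall rho, rho \in M -> deep sg L T rho)
  (apartM : apart sg T t (mem M)).

Let UM : uniq (map fst M).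
Proof.
rewrite map_inj_in_uniq //; apply: (apart_fst_inj sgP _ apartM).
by apply: leq_ltn_trans ltlrt.
Qed.

Let L_gt0 : 0 < L.
Proof. by apply: leq_ltn_trans ltlrL. Qed.

Let leMW : m <= W.
Proof. by have := ball_volume_ge e m r; lia. Qed.

Let leJW : J <= m + e.+1 * W.
Proof. by rewrite leq_add2l leq_mul2l ball_volume_mono. Qed.

(** A hit yields a walk of at most [l + 1] steps through the query and one of at most [r] steps with
    the same end. From different given edges they contradict [apartM]; from the same edge,
    [walk_end_inj] makes their last half-edges equal. *)
Lemma ball_no_hit k : valid qry ok (answers qry sg k) -> k < J ->
  ok (answers qry sg k) (sg (qry (answers qry sg k))).
Proof.
move=> vk ltk; set s := answers qry sg k; set q := qry s.
have szs : size s = k by rewrite size_answers.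
have fq : q \notin revealed qry s by apply: (ball_fresh m_gt0 leMW leJW UM); rewrite ?szs.
apply/negP=> /(nthP h0.1)[b]; rewrite size_map size_seen szs leq_min => /andP[ltbm ltbW].
rewrite (nth_map h0) ?size_seen ?szs ?leq_min ?ltbm // nth_seen // => bE.
have [rb [xb [pb [rbM xrb hpb szb lb]]]] := origin_walk ltbW ltbm.
have nb : near sg rb r (tgt sg q).
  by exists xb, pb; split=> //; rewrite lb tgt_sg // -/s bE.
(* The query is not the half-edge through which vertex [b] was reached: that one is already
   revealed, or else two given half-edges would be paired with each other. *)
have NE : q != sg (nth h0 (M ++ s) b).
  apply: contra fq => /eqP qE; rewrite mem_cat.
  have [ltb|leb] := ltnP b m.
    have qrb : ball_qry h0 M (answers qry sg b) = nth h0 M b.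
      by rewrite /ball_qry /origin_index size_answers ltb nth_cat ltb.
    have [ltbk|lekb] := ltnP b k.
      apply/orP; left; have -> : q = nth h0 s b.
        by rewrite nth_answers // qrb qE nth_cat ltb.
      by rewrite mem_nth // szs.
    have ltkm : k < m by apply: leq_ltn_trans ltb.
    have qM : q = nth h0 M k by rewrite /q /ball_qry szs ltkm /origin_index ltkm nth_cat ltkm.
    move: qE; rewrite nth_cat ltb => qE.
    have [kb|nkb] := eqVneq k b.
      by have := pairing_neq (nth h0 M b) sgP; rewrite -qE qM kb eqxx.
    have [_ n1] := near0 sgP (nth h0 M k); have [n2 _] := near0 sgP (nth h0 M b).
    have E1 : tgt sg (nth h0 M k) = (nth h0 M b).1 by rewrite -qM qE tgt_sg.
    rewrite E1 in n1.
    have := apartM (mem_nth h0 ltkm) (mem_nth h0 ltb) _ (leq0n _) (leq0n _) n1 n2.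
    by rewrite nth_uniq // => /(_ nkb); lia.
  have ltbk : b - m < k by lia.
  apply/orP; right; apply/mapP; exists (b - m); first by rewrite mem_iota szs.
  by rewrite qE nth_cat ltnNge leb /= nth_answers // sgK take_answers // ltnW.
have [ltkm|lemk] := ltnP k m.
  have qE : q = nth h0 M k by rewrite /q /ball_qry szs ltkm /origin_index ltkm nth_cat ltkm.
  have qM : q \in M by rewrite qE mem_nth.
  have [_ nq] := near0 sgP q.
  have [qrb|nqr] := eqVneq q rb; last first.
    by have := apartM qM rbM nqr (leq0n _) lerT nq nb; lia.
  have := @walk_end_inj _ _ _ _ _ sgP L_gt0 q q xb [::] pb (deepM qM).
  rewrite inE eqxx qrb xrb => /(_ isT isT isT hpb (leq0n _) (leq_trans szb lerT)).
  have szL : size (Nil H) + size pb < L by rewrite /=; lia.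
  move=> /(_ szL); rewrite /= lb tgt_sg // -/s bE -qrb => /(_ erefl) E.
  by rewrite E eqxx in NE.
have lta : origin_index M k < vol l.
  by rewrite /origin_index [k < m]ltnNge lemk /= ltn_divLR //; lia.
have [ra [xa [pa [raM xra hpa sza la]]]] := origin_walk lta (origin_index_lt m_gt0 leMW leJW UM k).
have hpq : path (step sg) xa (rcons pa q).
  rewrite rcons_path hpa la /step /= sgK ball_qry1 szs eqxx /=.
  by rewrite /q /ball_qry szs ltnNge lemk /= sib_neq.
have szq : size (rcons pa q) <= l.+1 by rewrite size_rcons.
have na : near sg ra l.+1 (tgt sg q) by exists xa, (rcons pa q); rewrite last_rcons.
have [eab|nab] := eqVneq ra rb; last first.
  by have := apartM raM rbM nab ltlT lerT na nb; rewrite leqNgt ltlrt.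
subst rb.
have := walk_end_inj sgP L_gt0 (deepM raM) xra xrb hpq hpb (leq_trans szq ltlT) (leq_trans szb lerT).
rewrite last_rcons lb tgt_sg // -/s bE => /(_ _ erefl) E.
move: NE; rewrite E ?eqxx //; apply: leq_ltn_trans ltlrL.
exact: leq_add.
Qed.

Lemma ball_survives : sg \in survivors qry ok J.
Proof.
have vA k : k <= J -> valid qry ok (answers qry sg k).
  elim: k => [_|k IHk ltk]; first exact: valid_nil.
  have vk := IHk (ltnW ltk).
  have fq : qry (answers qry sg k) \notin revealed qry (answers qry sg k).
    by apply: (ball_fresh m_gt0 leMW leJW UM); rewrite ?size_answers.
  apply: valid_rcons => //; rewrite inE ball_no_hit //= pairing_neq // andbT.
  by apply: extensions_fresh fq; rewrite inE sgP size_answers /=.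
by rewrite inE sgP; apply/forallP=> k; apply: ball_no_hit => //; apply: vA; apply: ltnW.
Qed.

End BallSurvival.

(** * Summing the blocked half-edges *)

Lemma ball_volume_exp e m l : 2 * m * e ^ l <= ball_volume e m l.
Proof.
elim: l => [|l IHl] /=; first by rewrite muln1.
by rewrite expnS mulnCA (leq_trans _ (leq_addl _ _)) // leq_mul.
Qed.

Lemma sum_ord_id n : 2 * \sum_(k < n) k = n * n.-1.
Proof.
elim: n => [|n IHn]; first by rewrite big_ord0.
by rewrite big_ord_recr mulnDr IHn; case: n {IHn} => //= n; lia.
Qed.

(* [l = r] is the case of even [t] (no edge may join two balls of radius [r]); [r = l + 1]
   is the case of odd [t] (balls of radius [r] are disjoint). *)
Lemma sum_blocked e m l r : 0 < m -> l <= r <= l.+1 ->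
  2 * m * m.-1 * e ^ (l + r).+2 <=
    \sum_(k < m + e.+1 * ball_volume e m l)
       (e.+2 * minn (m + k) (ball_volume e m r) - k - minn k (ball_volume e m r - m) - 1).
Proof.
move=> m_gt0 /andP[lelr]; rewrite leq_eqVlt ltnS => /orP[/eqP rE|lerl].
  (* For [r = l + 1] every answer is recorded, since [W = m + J], and step [k] blocks at least
     [e * k] half-edges. *)
  have WE : ball_volume e m r = m + (m + e.+1 * ball_volume e m l) by rewrite rE /=; lia.
  set J := m + e.+1 * ball_volume e m l in WE *.
  have leJ : 2 * m * e ^ l.+1 <= J.
    rewrite expnS mulnCA /J; apply: leq_trans (leq_addl _ _).
    by rewrite leq_mul // ball_volume_exp.
  apply: (@leq_trans (\sum_(k < J) e * k)); last first.
    apply: leq_sum => k _; have := ltn_ord k; rewrite WE addKn.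
    rewrite (minn_idPl _) ?leq_add2l ?(ltnW (ltn_ord k)) // (minn_idPl _) ?(ltnW (ltn_ord k)) // => ltk.
    nia.
  rewrite -big_distrr /= -(@leq_pmul2l 2) // [leqRHS]mulnCA sum_ord_id rE.
  have -> : (l + l.+1).+2 = 1 + (l.+1 + l.+1) by lia.
  rewrite !expnD expn1; move: leJ; set X := e ^ l.+1 => leJ.
  have X1 : 0 < e -> 0 < X by move=> e0; rewrite expn_gt0 e0.
  case: (posnP e) => [->|/X1 {}X1]; first by rewrite !(mul0n, muln0).
  have {}X1 : 2 * m * X * (2 * m * X).-1 <= J * J.-1 by apply: leq_mul => //; lia.
  apply: leq_trans (leq_mul (leqnn e) X1).
  have : 2 * (m * m.-1 * (X * X)) * 2 <= 2 * m * X * (2 * m * X).-1.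
    have -> : 2 * (m * m.-1 * (X * X)) * 2 = 2 * m * X * (2 * m.-1 * X) by ring.
    by rewrite leq_mul2l; apply/orP; right; nia.
  move=> le; have := leq_mul (leqnn e) le; rewrite -!mulnA; nia.
have rE : r = l by apply/eqP; rewrite eqn_leq lerl.
subst r; set W := ball_volume e m l; set s := 2 * m + e * W.
have leW : 2 * m <= W := ball_volume_ge e m l.
have JE : m + e.+1 * W = (W - m) + s by rewrite /s; lia.
(* For [r = l] only the last [s] steps are counted, when all [W] vertices are recorded: the blocked
   number then runs down from [s - 1] to 0. *)
rewrite JE big_split_ord /=; apply: leq_trans (leq_addl _ _).
have -> : \sum_(i < s) (e.+2 * minn (m + (W - m + i)) W - (W - m + i) - minn (W - m + i) (W - m) - 1)
   = \sum_(i < s) i.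
  rewrite [RHS](reindex_inj rev_ord_inj) /=; apply: eq_bigr => i _.
  have := ltn_ord i; rewrite (minn_idPr _); last by lia.
  by rewrite (minn_idPr _) ?leq_addr //; have : s = 2 * m + e * W by []; lia.
rewrite -(@leq_pmul2l 2) // sum_ord_id.
have les : 2 * m * e ^ l.+1 <= s.
  rewrite expnS mulnCA /s; apply: leq_trans (leq_addl _ _).
  by rewrite leq_mul // ball_volume_exp.
have -> : (l + l).+2 = l.+1 + l.+1 by lia.
rewrite expnD; move: les; set X := e ^ l.+1 => les.
apply: (@leq_trans (2 * m * X * (2 * m * X).-1)); last by apply: leq_mul => //; lia.
have -> : 2 * (2 * m * m.-1 * (X * X)) = 2 * m * X * (2 * m.-1 * X) by ring.
by rewrite leq_mul2l; apply/orP; right; nia.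
Qed.

(** * Counting *)

Section RandomPairing.
Variables (V : finType) (e : nat).
Notation H := (V * 'I_e.+2)%type.
Notation N := #|{: H}|.

Definition apart_set (sg : {perm H}) (L T t : nat) (A : {set H}) : Prop :=
  (forall rho, rho \in A -> deep sg L T rho) /\ apart sg T t (mem A).

(** Choosing one half-edge per edge, the deep ones of one colour form an apart set, so a colour
    accounts for at most [2 * m] deep half-edges; [card_not_deep] bounds the rest. *)
Lemma chromatic_index_geq (sg : {perm H}) (L T t m : nat) (sgP : sg \in pairings H)
    (L_gt0 : 0 < L) : 1 < L -> t <= T ->
  (forall A : {set H}, #|A| = m -> ~ apart_set sg L T t A) ->
  N <= 2 * m * distance_chromatic_index (pgraph sgP L_gt0) t + 4 * e.+3 ^ T * #|bad sg L|.
Proof.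
move=> L_gt1 letT noA; rewrite /distance_chromatic_index.
case: ex_minnP => k /asboolP[col [colk colP]] _.
pose D := [set h | deep sg L T h].
pose D' := [set h in D | enum_rank h < enum_rank (sg h)].
have leD : #|D| <= 2 * #|D'|.
  apply: (@leq_trans #|D' :|: sg @: D'|).
    apply/subset_leq_card/subsetP=> h; rewrite inE => dh.
    have [lt|le] := ltnP (enum_rank h) (enum_rank (sg h)); first by rewrite !inE dh lt.
    rewrite inE; apply/orP; right; apply/imsetP; exists (sg h); last by rewrite (pairingK sgP).
    rewrite !inE (deep_sg _ _ sgP) dh (pairingK sgP) /= ltn_neqAle le andbT.
    by rewrite (inj_eq (@ord_inj _)) (inj_eq enum_rank_inj) pairing_neq.
  by rewrite (leq_trans (leq_card_setU _ _)) // mul2n -addnn leq_add2l leq_imset_card.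
pose c h := col (hedge sgP L_gt0 h).
have deepc h : deep sg L T h -> clean sg L h.
  by move=> dh; apply: (deep_clean (p := [::]) dh).
have cD h : h \in D' -> c h < k.
  by rewrite !inE => /andP[dh _]; apply: colk; apply: hedge_edges; apply: deepc.
have leS i : #|[set h in D' | c h == i]| <= m.
  rewrite leqNgt; apply/negP=> ltm.
  have [A sA cA] : exists2 A : {set H}, A \subset [set h in D' | c h == i] & #|A| = m.
    have /card_geqP[xs [Ux szx sx]] := ltnW ltm.
    exists [set x in xs]; first by apply/subsetP=> x; rewrite inE => /sx.
    by rewrite cardsE (card_uniqP Ux).
  apply: (noA A cA); split=> [rho|rho rho' a b v] /(subsetP sA).
    by rewrite !inE => /andP[/andP[]].
  rewrite !inE => /andP[/andP[dr ltr] /eqP cr] /(subsetP sA).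
  rewrite !inE => /andP[/andP[dr' ltr'] /eqP cr'] neq leaT lebT na nb.
  rewrite leqNgt; apply/negP=> ltt.
  have eN : hedge sgP L_gt0 rho != hedge sgP L_gt0 rho'.
    apply: contraNneq neq => /(hedge_inj L_gt1 (deepc _ dr))[->//|E].
    by move: ltr ltr'; rewrite E (pairingK sgP) => l1 l2; have := ltn_trans l1 l2; rewrite ltnn.
  have := colP _ _ (hedge_edges sgP L_gt0 (deepc _ dr)) (hedge_edges sgP L_gt0 (deepc _ dr')) eN.
  by rewrite -/(c rho) -/(c rho') cr cr' eqxx => /(_ (near_edge_dist sgP L_gt0 dr dr' leaT lebT na nb ltt)).
have leD' : #|D'| <= k * m.
  apply: (@leq_trans (\sum_(i < k) #|[set h in D' | c h == i]|)); last first.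
    by rewrite -[X in X * m]card_ord -sum_nat_const leq_sum.
  rewrite -sum1_card; apply: (@leq_trans (\sum_(h in D') \sum_(i < k) (c h == i))).
    apply: leq_sum => h hD; rewrite (bigD1 (Ordinal (cD h hD))) //= eqxx leq_addr //.
  rewrite exchange_big leq_sum // => i _; rewrite -sum1_card big_mkcond [leqRHS]big_mkcond.
  by apply: leq_sum => h _; rewrite [in leqRHS]inE; case: (h \in D'); case: (c h == i).
have leC : #|~: D| <= 4 * e.+3 ^ T * #|bad sg L|.
  apply: leq_trans (card_not_deep T sgP L_gt0); apply/subset_leq_card/subsetP=> h.
  by rewrite !inE.
by have := cardsC D; rewrite -cardsT; lia.
Qed.

(* For [t = 1] the exploration bound falls short of [2 m (m-1) e^t / N], but there [m] can be
   taken larger than the number of vertices. *)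
Lemma card_apart_pairings (R : realType) (L T t : nat) (A : {set H}) :
  0 < t -> t <= T -> t.+1 < L -> 0 < #|A| -> (1 < t) || (#|V| < #|A|) ->
  (#|[set sg in pairings H | `[< apart_set sg L T t A >]]|%:R
   <= expR (- (2 * #|A| * #|A|.-1 * e ^ t)%:R / N%:R) * #|pairings H|%:R :> R)%R.
Proof.
move=> t_gt0 letT ltL A_gt0 hyp; set X := [set sg in _ | _].
(* A single pairing for which [A] is apart already forces its half-edges to lie at distinct
   vertices, which excludes [#|V| < #|A|]. *)
have [->|[sg0]] := set_0Vmem X; first by rewrite cards0 mulr_ge0 ?expR_ge0.
rewrite inE => /andP[sg0P /asboolP[_ ap0]].
have UA : uniq (map fst (enum A)).
  rewrite map_inj_in_uniq ?enum_uniq // => x y; rewrite !mem_enum.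
  exact: (apart_fst_inj sg0P t_gt0 ap0).
have leAV : #|A| <= #|V|.
  by rewrite cardE -(size_map fst) -(card_uniqP UA) max_card.
move: hyp; rewrite [#|V| < _]ltnNge leAV orbF => t_gt1.
(* These radii satisfy [l + r + 2 = t], so [l.+1 + r < t] holds with nothing to spare. *)
pose l := t./2.-1; pose r := t - l.+2.
have lr : l <= r <= l.+1.
  by rewrite /r /l; have := odd_double_half t; case: (odd t); lia.
have trl : t = (l + r).+2 by rewrite /r /l; have := odd_double_half t; case: (odd t); lia.
have [h0 _] := card_gt0P A_gt0.
pose m := #|A|; pose W := ball_volume e m r; pose J := m + e.+1 * ball_volume e m l.
have szA : size (enum A) = m by rewrite -cardE.
have sX : X \subset survivors (ball_qry h0 (enum A)) (ball_ok (enum A) W) J.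
  apply/subsetP=> sg; rewrite inE => /andP[sgP /asboolP[dA apA]].
  have := @ball_survives V e sg L T t l r h0 (enum A) sgP; rewrite szA; apply => //.
  all: try lia.
  - exact: enum_uniq.
  - by move=> rho; rewrite mem_enum => /dA.
  - by move=> rho rho' i j v; rewrite !mem_enum; apply: apA.
apply: le_trans (_ : #|survivors (ball_qry h0 (enum A)) (ball_ok (enum A) W) J|%:R <= _)%R.
  by rewrite ler_nat subset_leq_card.
have leJW : J <= m + e.+1 * W by rewrite leq_add2l leq_mul2l ball_volume_mono //; case/andP: lr.
have := @card_ball_survivors V e h0 (enum A) W J; rewrite szA.
have leW : m <= W by have := ball_volume_ge e m r; rewrite -/W; lia.
move=> /(_ A_gt0 leW leJW UA R) le; apply: le_trans le _.
rewrite ler_wpM2r // ler_expR !mulNr lerN2 ler_wpM2r ?invr_ge0 // ler_nat.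
have := sum_blocked e A_gt0 lr; rewrite -trl -/m => le; apply: leq_trans le _.
by apply: leq_sum => k _; rewrite /blocked szA.
Qed.

Local Open Scope ring_scope.

(** By the union bound at most a quarter of the pairings have an apart set of size [m]. If all
    others had more than [2 * C] bad half-edges, the mean would exceed the bound [C] of
    [sum_card_bad_leq]. *)
Lemma exists_pairing (R : realType) (L T t m : nat) : (0 < #|pairings H|)%N ->
  (0 < t)%N -> (t <= T)%N -> (t.+1 < L)%N -> (4 * L <= N)%N -> (0 < m)%N ->
  (1 < t)%N || (#|V| < m)%N ->
  'C(N, m)%:R * expR (- (2 * m * m.-1 * e ^ t)%:R / N%:R) <= 4^-1 :> R ->
  exists sg : {perm H}, [/\ sg \in pairings H,
    (#|bad sg L| <= 2 * (L * e.+1 ^ L * (2 * L * e.+2)))%N &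
    forall A : {set H}, #|A| = m -> ~ apart_set sg L T t A].
Proof.
move=> P_gt0 t_gt0 letT ltL leN m_gt0 hyp leC; set C := (L * _ * _)%N.
apply: contrapT => noex.
pose X := [set sg in pairings H | `[< exists2 A : {set H}, #|A| = m & apart_set sg L T t A >]].
have cX : #|X|%:R <= 4^-1 * #|pairings H|%:R :> R.
  pose Y A := [set sg in pairings H | `[< apart_set sg L T t A >]].
  have leXY : (#|X| <= \sum_(A : {set H} | #|A| == m) #|Y A|)%N.
    apply: leq_trans (_ : #|\bigcup_(A : {set H} | #|A| == m) Y A| <= _)%N; last first.
      apply: (big_rec2 (fun (A : {set {perm H}}) n => #|A| <= n)%N); first by rewrite cards0.
      move=> A n B _ le; apply: leq_trans (leq_card_setU _ _) _; by rewrite leq_add2l.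
    apply/subset_leq_card/subsetP=> sg; rewrite inE => /andP[sgP /asboolP[A /eqP cA apA]].
    by apply/bigcupP; exists A => //; rewrite inE sgP; apply/asboolP.
  apply: le_trans (_ : _ <= (\sum_(A : {set H} | #|A| == m) #|Y A|)%N%:R) _; first by rewrite ler_nat.
  apply: le_trans (ler_wpM2r _ leC) => //.
  rewrite -mulrA natr_sum -card_draws.
  have -> : #|[set A : {set H} | #|A| == m]| = #|[pred A : {set H} | #|A| == m]|.
    by apply: eq_card => A; rewrite inE.
  rewrite mulr_natl -sumr_const; apply: ler_sum => A /eqP cA.
  by have := @card_apart_pairings R L T t A t_gt0 letT ltL; rewrite cA; apply.
have := sum_card_bad_leq (e := e) (V := V) R leN; rewrite -/C.
apply/negP; rewrite -ltNge.
have : (#|pairings H :\: X| * (2 * C).+1 <= \sum_(sg in pairings H) #|bad sg L|)%N.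
  rewrite -sum_nat_const [leqRHS](bigID (mem (pairings H :\: X))) /=.
  apply: leq_trans (leq_addr _ _); rewrite [leqLHS]big_mkcond [leqRHS]big_mkcond.
  apply: leq_sum => sg _; case: ifP => // /setDP[sgP]; rewrite inE sgP /= => /asboolPn noA.
  rewrite ltnNge; apply/negP=> leb; apply: noex.
  by exists sg; split=> // A cA apA; apply: noA; exists A.
have cD : #|pairings H :\: X|%:R = #|pairings H|%:R - #|X|%:R :> R.
  rewrite -natrB ?subset_leq_card //; last by apply/subsetP=> sg; rewrite inE => /andP[].
  by rewrite cardsD (setIidPr _) //; apply/subsetP=> sg; rewrite inE => /andP[].
rewrite -(ler_nat R) natrM cD => le; apply: lt_le_trans le.
have P0 : 0 < #|pairings H|%:R :> R by rewrite ltr0n.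
have -> : (2 * C).+1%:R = 2 * C%:R + 1 :> R by rewrite -natr1 natrM.
set c : R := C%:R; have c0 : 0 <= c by [].
by nra.
Qed.

End RandomPairing.

(** * Numerical estimates and choice of parameters *)

Local Open Scope classical_set_scope.
Local Open Scope ring_scope.

(** One term of the binomial expansion gives [C(N, m) p^m <= (1 + p)^N <= exp (p N) <= exp m]. *)
Lemma bin_leq_expR (R : realType) (N m : nat) (p : R) :
  0 < p -> p * N%:R <= m%:R -> 'C(N, m)%:R <= expR (m%:R * (1 - ln p)).
Proof.
move=> p0 pN; have [ltNm|lemN] := ltnP N m; first by rewrite bin_small // expR_ge0.
have le1 : 'C(N, m)%:R * p ^+ m <= (1 + p) ^+ N.
  rewrite exprDn (bigD1 (Ordinal (lemN : (m < N.+1)%N))) //= expr1n mul1r mulr_natl.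
  by rewrite lerDl sumr_ge0 // => i _; rewrite mulrn_wge0 // mulr_ge0 ?exprn_ge0 // ltW.
have le2 : (1 + p) ^+ N <= expR m%:R.
  apply: le_trans (_ : expR p ^+ N <= _).
    by rewrite lerXn2r ?nnegrE ?expR_ge0 ?expR_ge1Dx // addr_ge0 // ltW.
  by rewrite -expRM_natr ler_expR.
have pE : p ^+ m = expR (m%:R * ln p).
  by rewrite mulrC expRM_natr lnK.
rewrite mulrBr mulr1 expRB -pE ler_pdivlMr ?exprn_gt0 //.
exact: le_trans le1 le2.
Qed.

Lemma bernoulli_inequality (R : realFieldType) (n : nat) (y : R) :
  0 <= y <= 1 -> 1 - n%:R * y <= (1 - y) ^+ n.
Proof.
move=> /andP[y0 y1]; elim: n => [|n IHn]; first by rewrite mul0r subr0 expr0.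
rewrite exprS; apply: le_trans (ler_wpM2l _ IHn); last by lra.
by have : 0 <= n%:R :> R by []; rewrite -natr1; nra.
Qed.

(** The exponent is at most [m (1 + s - 2 e^t (m - 1) / N)], and the last term is nearly
    [2 d^t p = (1 + delta) s]. The surplus, at least [delta s / 2 >= 3], covers both the 1 and the
    loss from [m - 1], leaving at most [- m <= - 2]. *)
Lemma union_bound (R : realType) (N m e t : nat) (delta : R) :
  let d := e.+2%:R : R in
  let p := (1 + delta) * (t%:R * ln d) / (2 * d ^+ t) in
  (0 < N)%N -> (1 < m)%N -> p * N%:R <= m%:R -> 2 * d ^+ t <= N%:R ->
  0 < delta <= 1 -> 6 <= delta * (t%:R * ln d) -> 8 * t%:R <= delta * d ->
  'C(N, m)%:R * expR (- (2 * m * m.-1 * e ^ t)%:R / N%:R) <= 4^-1 :> R.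
Proof.
move=> d p N0 m1 pN dN /andP[del0 del1] lnd td.
set s := t%:R * ln d in p pN lnd *.
have d0 : 0 < d by rewrite ltr0n.
have dt0 : 0 < d ^+ t by rewrite exprn_gt0.
have N0R : 0 < N%:R :> R by rewrite ltr0n.
have s6 : 6 <= s by nra.
have s0 : 0 < s by apply: lt_le_trans s6.
have p0 : 0 < p by rewrite /p divr_gt0 // mulr_gt0 //; lra.
have lnp : - s <= ln p.
  have -> : - s = ln (d ^- t).
    by rewrite lnV ?posrE // lnXn // /s mulr_natl.
  rewrite ler_ln ?posrE ?invr_gt0 // /p invfM mulrA ler_peMl ?invr_ge0 ?(ltW dt0) //.
  by rewrite ler_pdivlMr //; nra.
have eE : e%:R = d - 2 :> R by rewrite /d -!natr1; lra.
(* Here [8 t <= delta d] pays for replacing [e = d - 2] by [d], through Bernoulli. *)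
have bern : d ^+ t * (1 - delta / 4) <= e%:R ^+ t.
  have : (1 - 2 * t%:R / d) * d ^+ t <= e%:R ^+ t.
    have -> : e%:R = d * (1 - 2 / d) by rewrite eE mulrBr mulr1 mulrCA divff ?mulr1 // gt_eqF.
    rewrite exprMn mulrC ler_wpM2l ?(ltW dt0) //.
    apply: le_trans (bernoulli_inequality t _); first by rewrite (mulrC 2) -mulrA.
    by rewrite divr_ge0 ?(ltW d0) //= ler_pdivrMr // mul1r /d ler_nat.
  move=> le; apply: le_trans le; rewrite mulrC ler_wpM2r ?(ltW dt0) //.
  rewrite lerB // ler_pdivrMr //; lra.
have mN : p - N%:R^-1 <= m.-1%:R / N%:R.
  rewrite ler_pdivlMr // mulrBl mulVf ?gt_eqF //.
  by rewrite -(ltn_predK m1) -natr1 in pN; lra.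
apply: le_trans (_ : expR (m%:R * (1 + s - 2 * (e%:R ^+ t) * (m.-1%:R / N%:R))) <= _).
  rewrite [leRHS](_ : _ = expR (m%:R * (1 + s)) * expR (- (2 * m * m.-1 * e ^ t)%:R / N%:R)); last first.
    by rewrite -expRD; congr expR; rewrite !natrM natrX; field; rewrite gt_eqF.
  rewrite ler_wpM2r ?expR_ge0 //; apply: le_trans (bin_leq_expR p0 pN) _.
  by rewrite ler_expR ler_wpM2l // lerD2l lerNl.
have pe : (1 + delta / 2) * s <= 2 * e%:R ^+ t * p.
  apply: le_trans (_ : 2 * (d ^+ t * (1 - delta / 4)) * p <= _); last first.
    by rewrite ler_wpM2r ?(ltW p0) // ler_wpM2l.
  have -> : 2 * (d ^+ t * (1 - delta / 4)) * p = (1 - delta / 4) * (1 + delta) * s.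
    rewrite /p; by field; rewrite gt_eqF.
  by rewrite ler_wpM2r //; nra.
have ed : e%:R ^+ t <= d ^+ t by rewrite lerXn2r ?nnegrE ?ler0n ?(ltW d0) // eE; lra.
have eN : 2 * e%:R ^+ t / N%:R <= 1 :> R by rewrite ler_pdivrMr //; lra.
have main : 1 + s - 2 * (e%:R ^+ t) * (m.-1%:R / N%:R) <= - 1.
  have : 2 * e%:R ^+ t * (p - N%:R^-1) <= 2 * e%:R ^+ t * (m.-1%:R / N%:R).
    by rewrite ler_wpM2l // mulr_ge0 // exprn_ge0.
  by rewrite mulrBr; nra.
apply: le_trans (_ : expR (- 2) <= _).
  rewrite ler_expR; have : 2 <= m%:R :> R by rewrite ler_nat.
  nra.
rewrite expRN lef_pV2 ?posrE ?expR_gt0 //.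
have -> : expR 2 = expR 1 ^+ 2 :> R by rewrite -expRM_natr mul1r.
have e1 : 2 <= expR 1 :> R by have := expR_ge1Dx (1 : R); lra.
by rewrite expr2; nra.
Qed.

(** The factor [bool] provides two copies of each half-edge, which are paired with each other. *)
Lemma pairings_gt0 (n e : nat) : (0 < #|pairings (bool * 'I_n * 'I_e.+2)%type|)%N.
Proof.
pose f (h : bool * 'I_n * 'I_e.+2) := (~~ h.1.1, h.1.2, h.2).
have fK : involutive f by case=> [[b i] j]; rewrite /f /= negbK.
apply/card_gt0P; exists (perm (inv_inj fK)); apply: pairingsP => h; rewrite !permE ?fK //.
by case: h => [[[] i] j].
Qed.

(** With [m] about [p N], at least about [N / (2 m)], hence [1 / (2 p)], colours are needed. The
    target is [(1 - delta^2) / (2 p)]; the [delta^2] absorbs the half-edges that are not deep and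
    the rounding of [m]. *)
Lemma large_index_graph (R : realType) (t g e : nat) (delta : R) :
  let d := e.+2%:R : R in
  (0 < t)%N -> 0 < delta <= 1 -> 6 <= delta * (t%:R * ln d) -> 8 * t%:R <= delta * d ->
  exists G : sgraph, [/\ ((Posz g)%:E <= girth G)%E, (max_degree G <= e.+2)%N &
    (1 - delta) * (d ^+ t / (t%:R * ln d)) <= (distance_chromatic_index G t)%:R].
Proof.
move=> d t0 delP lnd td; have /andP[del0 del1] := delP.
set s := t%:R * ln d in lnd *.
pose p := (1 + delta) * s / (2 * d ^+ t).
have d0 : 0 < d by rewrite ltr0n.
have dt0 : 0 < d ^+ t by rewrite exprn_gt0.
have s6 : 6 <= s by nra.
have s0 : 0 < s by apply: lt_le_trans s6.
have p0 : 0 < p by rewrite /p divr_gt0 // mulr_gt0 //; lra.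
pose L := (g + t).+2.
pose C := (L * e.+1 ^ L * (2 * L * e.+2))%N.
pose K : R := (4 * e.+3 ^ t * (2 * C))%N%:R.
have K0 : 0 <= K by [].
(* The summands ensure in turn [4 L <= N], [2 d^t <= N], [2 <= p N] and, for the final estimate,
   [p K + 1 <= delta^2 p N]. *)
pose B : R := (4 * L)%N%:R + 2 * d ^+ t + 2 / p + (p * K + 1) / (delta ^+ 2 * p).
have B1 : 0 <= 2 / p by rewrite divr_ge0 // ltW.
have dp0 : 0 < delta ^+ 2 * p by rewrite mulr_gt0 // exprn_gt0.
have B2 : 0 <= (p * K + 1) / (delta ^+ 2 * p).
  by rewrite divr_ge0 ?(ltW dp0) // addr_ge0 // mulr_ge0 // ltW.
have L0 : 0 <= (4 * L)%N%:R :> R by [].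
have B0 : 0 <= B by rewrite /B; lra.
have [n nB] : exists n : nat, B < n%:R by exists (Num.bound B); apply: archi_boundP.
pose V := (bool * 'I_n)%type.
pose N := #|{: V * 'I_e.+2}|.
have NE : N = (2 * n * e.+2)%N by rewrite /N !card_prod card_bool !card_ord.
have BN : B <= N%:R.
  by apply: le_trans (ltW nB) _; rewrite ler_nat NE -mulnA mulnCA leq_pmulr.
have N0 : (0 < N)%N.
  by rewrite -(ltr_nat R); apply: lt_le_trans BN; rewrite /B; lra.
have N0R : 0 < N%:R :> R by rewrite ltr0n.
pose m := (Num.truncn (p * N%:R)).+1.
have /andP[mlo mhi] : (Num.truncn (p * N%:R))%:R <= p * N%:R < m%:R.
  by apply: truncn_itv; rewrite mulr_ge0 // ltW.
have mhi' : m%:R <= p * N%:R + 1 by rewrite /m -natr1; lra.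
have pN2 : 2 <= p * N%:R.
  by rewrite mulrC -ler_pdivrMr //; apply: le_trans BN; rewrite /B; lra.
have m1 : (1 < m)%N by rewrite -(ltr_nat R); lra.
have dN : 2 * d ^+ t <= N%:R by apply: le_trans BN; rewrite /B; lra.
have leN : (4 * L <= N)%N.
  by rewrite -(ler_nat R); apply: le_trans BN; rewrite /B; lra.
(* For [t = 1], [p d = (1 + delta) ln d / 2] exceeds 1, so [m > p N > #|V|]. *)
have hyp : (1 < t)%N || (#|{: V}| < m)%N.
  have [t1|t1] := ltnP 1 t; first by [].
  have {t1} t1 : t = 1%N by apply/eqP; rewrite eqn_leq t1.
  apply/orP; right; rewrite -(ltr_nat R); apply: lt_trans mhi.
  have -> : N%:R = #|{: V}|%:R * d by rewrite /N card_prod card_ord natrM.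
  rewrite mulrCA ltr_pMr; last first.
    have : 0 < N%:R :> R by [].
    by rewrite /N card_prod natrM pmulr_lgt0 // card_ord.
  by rewrite /p t1 expr1 invfM mulrA divfK ?gt_eqF // ltr_pdivlMr //; nra.
have le4 : 'C(N, m)%:R * expR (- (2 * m * m.-1 * e ^ t)%:R / N%:R) <= 4^-1 :> R.
  exact: (@union_bound R N m e t delta N0 m1 (ltW mhi) dN delP lnd td).
have L0' : (0 < L)%N by [].
have ltL : (t.+1 < L)%N by rewrite /L !ltnS leq_addl.
have [sg [sgP lebad noA]] := exists_pairing (pairings_gt0 n e) t0 (leqnn t)
  ltL leN (ltnW m1) hyp le4.
exists (pgraph sgP L0'); split.
- by apply: girth_pgraph; rewrite /L !leqW // leq_addr.
- exact: max_degree_pgraph.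
have := chromatic_index_geq sgP L0' isT (leqnn t) noA.
set k := distance_chromatic_index _ _ => lek.
have {}lek : N%:R <= 2 * m%:R * k%:R + K.
  rewrite /K -!natrM -natrD ler_nat; apply: leq_trans lek _.
  by rewrite leq_add2l leq_mul2l lebad orbT.
pose X := (1 - delta ^+ 2) / (2 * p).
have -> : (1 - delta) * (d ^+ t / s) = X.
  by rewrite /X /p; field; rewrite !gt_eqF // addr_gt0.
have X0 : 0 <= X by apply: divr_ge0; [nra | lra].
have m0 : 0 < 2 * m%:R :> R by rewrite mulr_gt0 // ltr0n.
rewrite -(ler_pM2l m0); apply: le_trans (_ : N%:R - K <= _); last by lra.
apply: le_trans (_ : 2 * (p * N%:R + 1) * X <= _).
  by rewrite ler_wpM2r // ler_wpM2l.
have -> : 2 * (p * N%:R + 1) * X = (1 - delta ^+ 2) * (N%:R + p^-1).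
  by rewrite /X; field; rewrite gt_eqF.
have : (p * K + 1) / (delta ^+ 2 * p) <= N%:R by apply: le_trans BN; rewrite /B; lra.
rewrite ler_pdivrMr // => le.
rewrite -(ler_pM2l p0).
have -> : p * ((1 - delta ^+ 2) * (N%:R + p^-1)) = (1 - delta ^+ 2) * (p * N%:R + 1).
  by field; rewrite gt_eqF.
have : 0 <= delta ^+ 2 by rewrite sqr_ge0.
nra.
Qed.

Theorem proposition3 (R : realType) (t : nat) (t_gt0 : (0 < t)%N) :
  exists f : nat -> R,
    (exists eps : nat -> R,
       eps @ \oo --> (0 : R) /\
       (\forall Delta \near \oo,
          f Delta = (1 + eps Delta)
                    * (Delta%:R ^+ t / (t%:R * ln (Delta%:R : R))))) /\
    (forall g Delta : nat, (3 <= g)%N -> (0 < Delta)%N ->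
       exists G : sgraph,
         [/\ ((Posz g)%:E <= girth G)%E,
             (max_degree G <= Delta)%N
           & f Delta <= (distance_chromatic_index G t)%:R]).
Proof.
pose X D : R := D%:R ^+ t / (t%:R * ln D%:R).
(* Quantifying over [g] here makes the eventual choice of [k], and with it [f], independent of the
   girth. *)
pose works (k D : nat) : Prop := forall g : nat, exists G : sgraph,
  [/\ ((Posz g)%:E <= girth G)%E, (max_degree G <= D)%N
    & (1 - k%:R^-1) * X D <= (distance_chromatic_index G t)%:R].
(* The cap [D.+1] makes a maximum exist; [k = 1] is always admissible because its bound is 0. *)
pose P D k := [&& (0 < k)%N, (k <= D.+1)%N & `[< works k D >]].
have exP D : exists k, P D k.
  exists 1%N; apply/and3P; split=> //; apply/asboolP => g.
  have [G [gG dG]] := edgeless_graph g D.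
  by exists G; split=> //; rewrite invr1 subrr mul0r.
have ubP D k : P D k -> (k <= D.+1)%N by case/and3P.
(* The largest admissible [k <= D + 1] tends to infinity with [D]; this turns the
   bounds for fixed [delta = 1/k] into a single function. *)
pose kmax D := ex_maxn (exP D) (ubP D).
exists (fun D => (1 - (kmax D)%:R^-1) * X D); split; last first.
  move=> g D _ _; rewrite /kmax; case: ex_maxnP => k /and3P[_ _ /asboolP kP] _.
  exact: kP.
exists (fun D => - (kmax D)%:R^-1); split; last exact: nearW.
apply/cvgr0Pnorm_lt => eps eps0.
pose K := (Num.bound eps^-1).+1.
have K0 : 0 < K%:R :> R by rewrite ltr0n.
have Keps : K%:R^-1 < eps.
  rewrite -[ltRHS]invrK ltf_pV2 ?posrE ?invr_gt0 //.
  apply: lt_trans (archi_boundP _) _; first by rewrite invr_ge0 ltW.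
  by rewrite ltr_nat.
(* For [delta = 1 / K] the first two summands give the hypotheses of [large_index_graph]; the others
   give [K <= D.+1] and [D = e.+2]. *)
pose B : R := expR (6 * K%:R) + 8 * t%:R * K%:R + K%:R + 2.
have t0 : 0 <= 8 * t%:R * K%:R :> R by rewrite !mulr_ge0.
have eK := expR_gt0 (6 * K%:R : R).
have wK D : B <= D%:R -> works K D.
  move=> DB g; case: D DB => [|[|e]] DB.
  - by move: DB; rewrite /B; lra.
  - by move: DB; rewrite /B; lra.
  apply: large_index_graph => //.
  - by rewrite invr_gt0 K0 invf_le1 // ler1n.
  - rewrite ler_pdivlMl // mulrC.
    have le1 : 6 * K%:R <= ln e.+2%:R :> R.
      rewrite -[leLHS]expRK ler_ln ?posrE ?expR_gt0 ?ltr0n //.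
      by move: DB; rewrite /B; lra.
    have t1 : 1 <= t%:R :> R by rewrite ler1n.
    by nra.
  - by rewrite ler_pdivlMl //; move: DB; rewrite /B; lra.
near=> D.
have DB : B <= D%:R by near: D; exact: nbhs_infty_ger.
have leKD : (K <= D.+1)%N.
  by rewrite -(ler_nat R) -natr1; move: DB; rewrite /B; lra.
rewrite /kmax; case: ex_maxnP => k /and3P[k0 _ _] /(_ K) leKk.
have {}leKk : (K <= k)%N by apply: leKk; apply/and3P; split=> //; apply/asboolP/wK.
rewrite normrN ger0_norm ?invr_ge0 //; apply: le_lt_trans Keps.
by rewrite lef_pV2 ?posrE ?ltr0n // ler_nat.
Unshelve. all: by end_near.
Qed.
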